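(* Let $x_0,y_0>0$, let $\Omega=\{(x,y):0<x<x_0,\ 0<y<y_0\}$, with $\Gamma_1,\Gamma_2,\Gamma_3$, the states $u,u_\alpha$, the cost functionals $J_i,J_{i\alpha}$ ($i=1,\dots,4$) and the constants $C_i, C_{i\alpha}$ ($i=1,\dots,6$) as defined in the context. Let $z_d\in\mathbb{R}$, $M_1,\dots,M_5>0$ and $\alpha>0$; the data among $g,q,b\in\mathbb{R}$ that are not controls are fixed. i) (Control $g$; $q,b$ fixed.) The minimizer of $J_1$ over $\mathbb{R}$ and the optimal value are $$g_{op}=-\frac{C_4 q x_0+ C_5 (b-z_d)}{2 x_0^2 \left(C_1+\frac{M_1}{x_0^4}\right)},$$ $$J_1(g_{op})=\frac{x_0 y_0 }{8 \left(C_1+\frac{M_1}{x_0^4}\right)} \Big[4 \left(C_1+\tfrac{M_1}{x_0^4}\right) \Big(C_2 q^2 x_0^2+ C_3 (b-z_d)^2+C_6 q x_0 (b-z_d)\Big)-\Big(C_4 q x_0+C_5 (b-z_d)\Big)^2\Big].$$ The minimizer $g_{\alpha_{op}}$ of $J_{1\alpha}$ and the value $J_{1\alpha}(g_{\alpha_{op}})$ are given by the same two expressions with every $C_i$ replaced by $C_{i\alpha}$. ii) (Control $q$; $g,b$ fixed.) The minimizer of $J_2$ over $\mathbb{R}$ and the optimal value are $$q_{op}=-\frac{C_4 g x_0^2+C_6 (b-z_d)}{2 x_0 \left(C_2+\frac{M_2}{x_0^3}\right)},$$ $$J_2(q_{op})=\frac{x_0 y_0 }{8 \left(C_2+\frac{M_2}{x_0^3}\right)}\Big[4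 \Big(C_2+\tfrac{M_2}{x_0^3}\Big) \Big(C_1 g^2 x_0^4+C_3 (b-z_d)^2+C_5 g x_0^2 (b-z_d)\Big)-\Big(C_4 g x_0^2+C_6 (b-z_d)\Big)^2\Big].$$ The minimizer $q_{\alpha_{op}}$ of $J_{2\alpha}$ and the value $J_{2\alpha}(q_{\alpha_{op}})$ are given by the same two expressions with every $C_i$ replaced by $C_{i\alpha}$. iii) (Control $b$; $g,q$ fixed.) The minimizer of $J_3$ over $\mathbb{R}$ and the optimal value are $$b_{op}=-\frac{C_5 g x_0^2+C_6 q x_0-2 C_3 z_d}{2 \left(C_3+\frac{M_3}{x_0}\right)},$$ $$J_3(b_{op})= \frac{x_0 y_0 }{8 \left(C_3+\frac{M_3}{x_0}\right)}\Big[4 \Big(C_3+\tfrac{M_3}{x_0}\Big) \Big(C_1 g^2 x_0^4+C_2 q^2 x_0^2+C_3 z_d^2+C_4 g q x_0^3-C_5 g x_0^2 z_d-C_6 q x_0 z_d\Big)-\Big(-2 C_3 z_d+C_5 g x_0^2+C_6 q x_0\Big)^2 \Big].$$ The minimizer $b_{\alpha_{op}}$ of $J_{3\alpha}$ and the value $J_{3\alpha}(b_{\alpha_{op}})$ are given by the same two expressions with every $C_i$ replaced by $C_{i\alpha}$. iv) (Control $(g,q)$; $b$ fixed.) The minimizer of $J_4$ over $\mathbb{R}\times\mathbb{R}$ is $$(g,q)_{op}=(g^{op},q^{op})=\left(\frac{b-z_d}{x_0^2}\Delta_1,\ \frac{b-z_d}{x_0}\Pi_1\right),$$ $$\Delta_1=\frac{C_4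 C_6-2 C_5 \left(C_2+\frac{M_5}{x_0^3}\right)}{4 \left(C_1+\frac{M_4}{x_0^4}\right) \left(C_2+\frac{M_5}{x_0^3}\right)-C_4^2},\qquad \Pi_1=\frac{C_4 C_5-2 C_6 \left(C_1+\frac{M_4}{x_0^4}\right)}{4 \left(C_1+\frac{M_4}{x_0^4}\right) \left(C_2+\frac{M_5}{x_0^3}\right)-C_4^2},$$ and $$J_4(g^{op},q^{op})=\frac{x_0 y_0(b-z_d)^2 }{2 \Big(C_4^2-4 \left(C_1+\frac{M_4}{x_0^4}\right) \left(C_2+\frac{M_5}{x_0^3}\right)\Big)}\Big[-4 C_3 \left(C_1+\tfrac{M_4}{x_0^4}\right) \left(C_2+\tfrac{M_5}{x_0^3}\right)+C_6^2 \left(C_1+\tfrac{M_4}{x_0^4}\right)+C_5^2 \left(C_2+\tfrac{M_5}{x_0^3}\right)+C_3 C_4^2-C_4 C_5 C_6\Big].$$ The minimizer $(g,q)_{\alpha_{op}}=(g_\alpha^{op},q_\alpha^{op})$ of $J_{4\alpha}$ and the value $J_{4\alpha}(g_\alpha^{op},q_\alpha^{op})$ are given by the same expressions with every $C_i$ replaced by $C_{i\alpha}$. v) As $\alpha\to\infty$ (all other data fixed): $g_{\alpha_{op}}\to g_{op}$, $q_{\alpha_{op}}\to q_{op}$, $b_{\alpha_{op}}\to b_{op}$, $(g_\alpha^{op},q_\alpha^{op})\to(g^{op},q^{op})$, and $|g_{\alpha_{op}}-g_{op}|$, $|q_{\alpha_{op}}-q_{op}|$, $|b_{\alpha_{op}}-b_{op}|$,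 $|g_\alpha^{op}-g^{op}|$, $|q_\alpha^{op}-q^{op}|$ are all $\mathcal{O}(1/\alpha)$. Moreover $J_{1\alpha}(g_{\alpha_{op}})\to J_1(g_{op})$, $J_{2\alpha}(q_{\alpha_{op}})\to J_2(q_{op})$, $J_{3\alpha}(b_{\alpha_{op}})\to J_3(b_{op})$, $J_{4\alpha}((g,q)_{\alpha_{op}})\to J_4((g,q)_{op})$, and in each of the four cases the absolute value of the difference is $\mathcal{O}(1/\alpha)$.
   Context: Domain: $\Omega=\{(x,y)\in\mathbb{R}^2:0<x<x_0,\ 0<y<y_0\}$; $\Gamma_1=\{x=0,\ 0\le y\le y_0\}$; $\Gamma_2=\{x=x_0,\ 0\le y\le y_0\}$; $\Gamma_3=\{y=0,\ 0<x<x_0\}\cup\{y=y_0,\ 0<x<x_0\}$. $\partial/\partial n$ is the outward normal derivative. States: for real constants $g,q,b$ and $\alpha>0$, $u$ is the unique (variational, $H^1(\Omega)$) solution of $$-\Delta u=g\ \text{in }\Omega,\quad u|_{\Gamma_1}=b,\quad -\tfrac{\partial u}{\partial n}|_{\Gamma_2}=q,\quad \tfrac{\partial u}{\partial n}|_{\Gamma_3}=0,$$ and $u_\alpha$ is the unique (variational) solution of $$-\Delta u_\alpha=g\ \text{in }\Omega,\quad -\tfrac{\partial u_\alpha}{\partial n}|_{\Gamma_1}=\alpha(u_\alpha-b),\quad -\tfrac{\partial u_\alpha}{\partial n}|_{\Gamma_2}=q,\quad \tfrac{\partial u_\alpha}{\partial n}|_{\Gamma_3}=0.$$ Cost functionals,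 with $H=L^2(\Omega)$, $Q=L^2(\Gamma_2)$, $B=L^2(\Gamma_1)$ and real numbers identified with constant functions: $J_1(g)=\frac12\|u-z_d\|_H^2+\frac{M_1}{2}\|g\|_H^2$ (as a function of $g\in\mathbb{R}$, with $q,b$ fixed); $J_2(q)=\frac12\|u-z_d\|_H^2+\frac{M_2}{2}\|q\|_Q^2$ (function of $q\in\mathbb{R}$, $g,b$ fixed); $J_3(b)=\frac12\|u-z_d\|_H^2+\frac{M_3}{2}\|b\|_B^2$ (function of $b\in\mathbb{R}$, $g,q$ fixed); $J_4(g,q)=\frac12\|u-z_d\|_H^2+\frac{M_4}{2}\|g\|_H^2+\frac{M_5}{2}\|q\|_Q^2$ (function of $(g,q)\in\mathbb{R}^2$, $b$ fixed). $J_{1\alpha},J_{2\alpha},J_{3\alpha},J_{4\alpha}$ are defined in the same way with $u$ replaced by $u_\alpha$. Constants: $C_1=\frac{2}{15}$, $C_2=\frac13$, $C_3=1$, $C_4=-\frac{5}{12}$, $C_5=\frac23$, $C_6=-1$; $C_{1\alpha}=\frac{2}{15}+\frac{2}{3\alpha x_0}+\frac{1}{\alpha^2x_0^2}$, $C_{2\alpha}=\frac13+\frac{1}{\alpha x_0}+\frac{1}{\alpha^2x_0^2}$, $C_{3\alpha}=1$, $C_{4\alpha}=-\frac{5}{12}-\frac{5}{3\alpha x_0}-\frac{2}{\alpha^2x_0^2}$, $C_{5\alpha}=\frac23+\frac{2}{\alpha x_0}$, $C_{6\alpha}=-1-\frac{2}{\alpha x_0}$. *)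

(* Defs.v *)
From HB Require Import structures.
From mathcomp Require Import all_boot all_order all_algebra.
From mathcomp Require Import all_classical all_reals all_analysis.

Set Implicit Arguments.
Unset Strict Implicit.
Unset Printing Implicit Defensive.
Import Order.TTheory GRing.Theory Num.Theory.
Import numFieldNormedType.Exports.

Local Open Scope classical_set_scope.
Local Open Scope ring_scope.

(** ** L^2 spaces over a subset, through extension by zero *)

Definition L2 d (T : measurableType d) (R : realType)
    (mu : {measure set T -> \bar R}) (D : set T) (f : T -> R) : Prop :=
  f \_ D \in Lfun mu 2%:E.

Definition L2norm d (T : measurableType d) (R : realType)
    (mu : {measure set T -> \bar R}) (D : set T) (f : T -> R) : \bar R :=
  'N[mu]_2%:E[EFin \o (f \_ D)].

(** ** The rectangle and its boundary *)

Definition leb1 (R : realType) : {measure set (measurableTypeR R) -> \bar R} :=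
  @lebesgue_measure R.

Definition leb2 (R : realType) :
    {measure set (measurableTypeR R * measurableTypeR R) -> \bar R} :=
  (@lebesgue_measure R \x @lebesgue_measure R)%E.

Definition Omega (R : realType) (x0 y0 : R) : set (R * R) :=
  [set z | 0 < z.1 < x0 /\ 0 < z.2 < y0].

(* The vertical sides Gamma_1 = {0} x [0, y0] and Gamma_2 = {x0} x [0, y0] are
   parametrized by arc length y |-> (0, y) and y |-> (x0, y); functions on them
   are functions of y on this segment.  The horizontal sides Gamma_3 carry a
   homogeneous Neumann condition and do not occur in the variational
   formulations. *)
Definition side (R : realType) (y0 : R) : set R := [set y | 0 <= y <= y0].

(** ** H^1 of the rectangle, with traces on Gamma_1 and Gamma_2 *)

Definition dx (R : realType) (f : R * R -> R) : R * R -> R :=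
  fun z => 'D_(1, 0) f z.

Definition dy (R : realType) (f : R * R -> R) : R * R -> R :=
  fun z => 'D_(0, 1) f z.

Fixpoint Ck (R : realType) (k : nat) (f : R * R -> R) : Prop :=
  if k is k'.+1 then
    [/\ continuous f, forall z, derivable f z (1, 0),
        forall z, derivable f z (0, 1), Ck k' (dx f) & Ck k' (dy f)]
  else continuous f.

Definition smooth (R : realType) (f : R * R -> R) : Prop := forall k, Ck k f.

Definition test_function (R : realType) (D : set (R * R))
    (phi : R * R -> R) : Prop :=
  [/\ smooth phi, compact (closure [set z | phi z != 0])
    & closure [set z | phi z != 0] `<=` D].

(* u belongs to H^1(D) and (p1, p2) is its weak gradient. *)
Definition weak_gradient (R : realType) (D : set (R * R))
    (u p1 p2 : R * R -> R) : Prop :=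
  [/\ L2 (leb2 R) D u, L2 (leb2 R) D p1, L2 (leb2 R) D p2
    & forall phi, test_function D phi ->
        (\int[leb2 R]_(z in D) (u z * dx phi z)) =
          - (\int[leb2 R]_(z in D) (p1 z * phi z)) /\
        (\int[leb2 R]_(z in D) (u z * dy phi z)) =
          - (\int[leb2 R]_(z in D) (p2 z * phi z))].

(* u belongs to H^1(Omega), (p1, p2) is its weak gradient, and t1, t2 are its
   traces on Gamma_1, Gamma_2.  The trace operator is the continuous extension
   of the restriction operator from the functions smooth up to the boundary,
   which are dense in H^1(Omega); thus every u in H^1(Omega) admits such p1,
   p2, t1, t2, and they are unique almost everywhere. *)
Definition H1_data (R : realType) (x0 y0 : R) (u p1 p2 : R * R -> R)
    (t1 t2 : R -> R) : Prop :=
  [/\ weak_gradient (Omega x0 y0) u p1 p2,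
      L2 (leb1 R) (side y0) t1, L2 (leb1 R) (side y0) t2
    & exists phi : (R * R -> R)^nat,
      [/\ forall n, smooth (phi n),
          [/\ L2norm (leb2 R) (Omega x0 y0) (phi n \- u) @[n --> \oo] --> 0%E,
              L2norm (leb2 R) (Omega x0 y0) (dx (phi n) \- p1) @[n --> \oo]
                --> 0%E
            & L2norm (leb2 R) (Omega x0 y0) (dy (phi n) \- p2) @[n --> \oo]
                --> 0%E],
          L2norm (leb1 R) (side y0) (fun y => phi n (0, y) - t1 y)
            @[n --> \oo] --> 0%E
        & L2norm (leb1 R) (side y0) (fun y => phi n (x0, y) - t2 y)
            @[n --> \oo] --> 0%E]].

(** ** The states *)

(* u|Gamma_1 = b and, for all v in H^1(Omega) with v|Gamma_1 = 0,
   (grad u, grad v) = (g, v) - (q, v)_{Gamma_2}. *)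
Definition dirichlet_solution (R : realType) (x0 y0 g q b : R)
    (u : R * R -> R) : Prop :=
  exists p1 p2 t2, H1_data x0 y0 u p1 p2 (cst b) t2 /\
  forall v r1 r2 s2, H1_data x0 y0 v r1 r2 (cst 0) s2 ->
    (\int[leb2 R]_(z in Omega x0 y0) (p1 z * r1 z + p2 z * r2 z)) =
    (\int[leb2 R]_(z in Omega x0 y0) (g * v z))
    - (\int[leb1 R]_(y in side y0) (q * s2 y)).

(* For all v in H^1(Omega), (grad u, grad v) + alpha (u, v)_{Gamma_1}
   = (g, v) - (q, v)_{Gamma_2} + alpha (b, v)_{Gamma_1}. *)
Definition robin_solution (R : realType) (x0 y0 alpha g q b : R)
    (u : R * R -> R) : Prop :=
  exists p1 p2 t1 t2, H1_data x0 y0 u p1 p2 t1 t2 /\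
  forall v r1 r2 s1 s2, H1_data x0 y0 v r1 r2 s1 s2 ->
    (\int[leb2 R]_(z in Omega x0 y0) (p1 z * r1 z + p2 z * r2 z))
    + alpha * (\int[leb1 R]_(y in side y0) (t1 y * s1 y)) =
    (\int[leb2 R]_(z in Omega x0 y0) (g * v z))
    - (\int[leb1 R]_(y in side y0) (q * s2 y))
    + alpha * (\int[leb1 R]_(y in side y0) (b * s1 y)).

(* The solutions exist and are unique up to equality almost everywhere in
   Omega; a representative is selected by choice. *)
Definition state (R : realType) (x0 y0 g q b : R) : R * R -> R :=
  xget (cst 0) [set u | dirichlet_solution x0 y0 g q b u].

Definition state_alpha (R : realType) (x0 y0 alpha g q b : R) : R * R -> R :=
  xget (cst 0) [set u | robin_solution x0 y0 alpha g q b u].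

(** ** The cost functionals *)

Definition sqnormH (R : realType) (x0 y0 : R) (f : R * R -> R) : R :=
  fine (L2norm (leb2 R) (Omega x0 y0) f) ^+ 2.

(* Squared norm of both Q = L^2(Gamma_2) and B = L^2(Gamma_1). *)
Definition sqnorm_side (R : realType) (y0 : R) (f : R -> R) : R :=
  fine (L2norm (leb1 R) (side y0) f) ^+ 2.

(* In the functionals below, S maps the data (g, q, b) to the state, i.e. S is
   [state x0 y0] or [state_alpha x0 y0 alpha]; the control is the last
   argument. *)
Definition J1 (R : realType) (S : R -> R -> R -> R * R -> R)
    (x0 y0 zd M1 q b g : R) : R :=
  2^-1 * sqnormH x0 y0 (S g q b \- cst zd) + M1 / 2 * sqnormH x0 y0 (cst g).

Definition J2 (R : realType) (S : R -> R -> R -> R * R -> R)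
    (x0 y0 zd M2 g b q : R) : R :=
  2^-1 * sqnormH x0 y0 (S g q b \- cst zd) + M2 / 2 * sqnorm_side y0 (cst q).

Definition J3 (R : realType) (S : R -> R -> R -> R * R -> R)
    (x0 y0 zd M3 g q b : R) : R :=
  2^-1 * sqnormH x0 y0 (S g q b \- cst zd) + M3 / 2 * sqnorm_side y0 (cst b).

Definition J4 (R : realType) (S : R -> R -> R -> R * R -> R)
    (x0 y0 zd M4 M5 b : R) (gq : R * R) : R :=
  2^-1 * sqnormH x0 y0 (S gq.1 gq.2 b \- cst zd)
  + M4 / 2 * sqnormH x0 y0 (cst gq.1) + M5 / 2 * sqnorm_side y0 (cst gq.2).

Definition minimizer (R : realType) (T : Type) (J : T -> R) (a : T) : Prop :=
  forall x, J a <= J x.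

Definition unique_minimizer (R : realType) (T : Type) (J : T -> R) (a : T) :
    Prop :=
  minimizer J a /\ forall x, minimizer J x -> x = a.

Definition argmin (R : realType) (T : pointedType) (J : T -> R) : T :=
  get [set a | minimizer J a].

(** ** The constants and the closed-form optima *)

Record coeffs (R : realType) :=
  Coeffs { C1 : R; C2 : R; C3 : R; C4 : R; C5 : R; C6 : R }.

Definition C (R : realType) : coeffs R :=
  {| C1 := 2 / 15; C2 := 1 / 3; C3 := 1;
     C4 := - (5 / 12); C5 := 2 / 3; C6 := -1 |}.

Definition Calpha (R : realType) (x0 alpha : R) : coeffs R :=
  {| C1 := 2 / 15 + 2 / (3 * alpha * x0) + 1 / (alpha ^+ 2 * x0 ^+ 2);
     C2 := 1 / 3 + 1 / (alpha * x0) + 1 / (alpha ^+ 2 * x0 ^+ 2);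
     C3 := 1;
     C4 := - (5 / 12) - 5 / (3 * alpha * x0) - 2 / (alpha ^+ 2 * x0 ^+ 2);
     C5 := 2 / 3 + 2 / (alpha * x0);
     C6 := -1 - 2 / (alpha * x0) |}.

Definition g_opt (R : realType) (c : coeffs R) (x0 zd M1 q b : R) : R :=
  - ((C4 c * q * x0 + C5 c * (b - zd))
     / (2 * x0 ^+ 2 * (C1 c + M1 / x0 ^+ 4))).

Definition J1_opt (R : realType) (c : coeffs R) (x0 y0 zd M1 q b : R) : R :=
  x0 * y0 / (8 * (C1 c + M1 / x0 ^+ 4)) *
  (4 * (C1 c + M1 / x0 ^+ 4)
     * (C2 c * q ^+ 2 * x0 ^+ 2 + C3 c * (b - zd) ^+ 2
        + C6 c * q * x0 * (b - zd))
   - (C4 c * q * x0 + C5 c * (b - zd)) ^+ 2).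

Definition q_opt (R : realType) (c : coeffs R) (x0 zd M2 g b : R) : R :=
  - ((C4 c * g * x0 ^+ 2 + C6 c * (b - zd))
     / (2 * x0 * (C2 c + M2 / x0 ^+ 3))).

Definition J2_opt (R : realType) (c : coeffs R) (x0 y0 zd M2 g b : R) : R :=
  x0 * y0 / (8 * (C2 c + M2 / x0 ^+ 3)) *
  (4 * (C2 c + M2 / x0 ^+ 3)
     * (C1 c * g ^+ 2 * x0 ^+ 4 + C3 c * (b - zd) ^+ 2
        + C5 c * g * x0 ^+ 2 * (b - zd))
   - (C4 c * g * x0 ^+ 2 + C6 c * (b - zd)) ^+ 2).

Definition b_opt (R : realType) (c : coeffs R) (x0 zd M3 g q : R) : R :=
  - ((C5 c * g * x0 ^+ 2 + C6 c * q * x0 - 2 * C3 c * zd)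
     / (2 * (C3 c + M3 / x0))).

Definition J3_opt (R : realType) (c : coeffs R) (x0 y0 zd M3 g q : R) : R :=
  x0 * y0 / (8 * (C3 c + M3 / x0)) *
  (4 * (C3 c + M3 / x0)
     * (C1 c * g ^+ 2 * x0 ^+ 4 + C2 c * q ^+ 2 * x0 ^+ 2 + C3 c * zd ^+ 2
        + C4 c * g * q * x0 ^+ 3 - C5 c * g * x0 ^+ 2 * zd
        - C6 c * q * x0 * zd)
   - (- (2 * C3 c * zd) + C5 c * g * x0 ^+ 2 + C6 c * q * x0) ^+ 2).

Definition Delta1 (R : realType) (c : coeffs R) (x0 M4 M5 : R) : R :=
  (C4 c * C6 c - 2 * C5 c * (C2 c + M5 / x0 ^+ 3))
  / (4 * (C1 c + M4 / x0 ^+ 4) * (C2 c + M5 / x0 ^+ 3) - C4 c ^+ 2).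

Definition Pi1 (R : realType) (c : coeffs R) (x0 M4 M5 : R) : R :=
  (C4 c * C5 c - 2 * C6 c * (C1 c + M4 / x0 ^+ 4))
  / (4 * (C1 c + M4 / x0 ^+ 4) * (C2 c + M5 / x0 ^+ 3) - C4 c ^+ 2).

Definition gq_opt (R : realType) (c : coeffs R) (x0 zd M4 M5 b : R) : R * R :=
  ((b - zd) / x0 ^+ 2 * Delta1 c x0 M4 M5, (b - zd) / x0 * Pi1 c x0 M4 M5).

Definition J4_opt (R : realType) (c : coeffs R) (x0 y0 zd M4 M5 b : R) : R :=
  x0 * y0 * (b - zd) ^+ 2
  / (2 * (C4 c ^+ 2
          - 4 * (C1 c + M4 / x0 ^+ 4) * (C2 c + M5 / x0 ^+ 3))) *
  (- (4 * C3 c * (C1 c + M4 / x0 ^+ 4) * (C2 c + M5 / x0 ^+ 3))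
   + C6 c ^+ 2 * (C1 c + M4 / x0 ^+ 4) + C5 c ^+ 2 * (C2 c + M5 / x0 ^+ 3)
   + C3 c * C4 c ^+ 2 - C4 c * C5 c * C6 c).

(* f a -> l as a -> +oo, at rate |f a - l| = O(1/a). *)
Definition cvg_rate (R : realType) (f : R -> R) (l : R) : Prop :=
  f a @[a --> +oo] --> l /\
  exists K : R, \forall a \near +oo, `|f a - l| <= K * a^-1.

(* Main.v *)
Require Import Defs.
From HB Require Import structures.
From mathcomp Require Import all_boot all_order all_algebra.
From mathcomp Require Import all_classical all_reals all_analysis.
From mathcomp Require Import measurable_realfun ring lra.

Set Implicit Arguments.
Unset Strict Implicit.
Unset Printing Implicit Defensive.
Import Order.TTheory GRing.Theory Num.Theory.
Import numFieldNormedType.Exports.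

Local Open Scope classical_set_scope.
Local Open Scope ring_scope.

(** Both boundary value problems have data that do not depend on y, so their
    solutions are explicit quadratic polynomials in x:
      u(x) = beta + (g x0 - q) x - g x^2 / 2,
    with beta = b for the Dirichlet condition and beta = b + (g x0 - q) / alpha
    for the Robin condition.  Integrating (u - zd)^2 over the rectangle turns
    the misfit into a quadratic form in (g, q, b - zd) whose coefficients are
    the C_i or C_{i alpha}; each cost is then a strictly convex quadratic
    polynomial of its control, and completing the square gives its minimizer
    and its minimum.  The optima are rational functions of the coefficients,
    with denominators that stay away from zero, and C_{i alpha} - C_i is a
    polynomial in 1 / alpha without constant term; hence the rates.

    The analytic work lies in showing that the state, which is chosen by its
    variational characterization, has the misfit of the explicit polynomial.
    It rests mainly on one identity, integral_Omega_dx: Fubini and the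
    fundamental theorem of calculus on horizontal lines.

    - Applied to P(x) phi(x, y) with phi smooth and extended by density, it is
      Green's formula H1_green for weight functions P(x).  With P = u' it says
      that the explicit polynomial satisfies the variational equation
      (flux_identity).

    - Applied to (x0 - x) phi^2, it bounds the L^2 norm of phi by those of its
      trace on Gamma_1 and of its x-derivative (poincare_smooth); by density, a
      function of H^1 with vanishing x-derivative and vanishing trace on
      Gamma_1 is null (H1_null).  Testing the equation satisfied by the
      difference w of two solutions with w itself shows that w is such a
      function (dirichlet_unique, robin_unique). *)

(** * Square-integrable functions on a measurable set *)

Section L2_theory.
Context d (T : measurableType d) (R : realType).
Variables (mu : {measure set T -> \bar R}) (D : set T).
Hypothesis mD : measurable D.
Implicit Types f g v w : T -> R.

Local Notation L2 := (L2 mu D).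
Local Notation L2norm := (L2norm mu D).
Local Notation integrable f := (mu.-integrable D (EFin \o f)).

Definition L2dot f g : R := \int[mu]_(x in D) (f x * g x).

Lemma integrable_L2M f g : L2 f -> L2 g -> integrable (f \* g).
Proof.
move=> lf lg; rewrite integrable_mkcond//.
have /Lfun1_integrable := Lfun2_mul_Lfun1 lf lg.
suff -> : (EFin \o (f \* g)) \_ D = EFin \o (f \_ D \* g \_ D) by [].
by apply/funext => x /=; rewrite !patchE; case: ifP => //; rewrite mul0r.
Qed.

Lemma restrict_sqrE f :
  (\int[mu]_x (`|((f \_ D) x)%:E| `^ 2) = \int[mu]_(x in D) (f x ^+ 2)%:E)%E.
Proof.
rewrite [RHS]integral_mkcond; apply: eq_integral => x _ /=; rewrite !patchE.
case: ifP => _; first by rewrite powR_mulrn// real_normK// num_real.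
by rewrite normr0 powR0.
Qed.

Lemma L2normE f :
  L2norm f = ((\int[mu]_(x in D) (f x ^+ 2)%:E) `^ 2^-1)%E.
Proof. by rewrite /Defs.L2norm unlock restrict_sqrE. Qed.

Lemma L2_of_sqr_integrable f :
  measurable_fun D f -> integrable (f \* f) -> L2 f.
Proof.
move=> mf fi; rewrite /Defs.L2 inE; apply/andP; rewrite !inE; split.
  exact/(measurable_restrictT _ mD).
rewrite /= /finite_norm -/(L2norm f) L2normE poweR_lty//.
exact: integrable_lty.
Qed.

Lemma sqr_L2norm f : L2 f -> fine (L2norm f) ^+ 2 = L2dot f f.
Proof.
move=> lf; have := integrable_fin_num mD (integrable_L2M lf lf).
rewrite L2normE /L2dot /Rintegral => /fineK/= <-.
rewrite -powR_mulrn ?powR_ge0// -powRrM mulVf// powRr1//.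
by apply: fine_ge0; apply: integral_ge0 => x _; rewrite lee_fin -expr2 sqr_ge0.
Qed.

Lemma L2B f g : L2 f -> L2 g -> L2 (f \- g).
Proof.
rewrite /Defs.L2 => lf lg.
rewrite (_ : _ \_ D = f \_ D - g \_ D).
  by rewrite rpredB// lee1n.
apply/funext => x /=; rewrite /= !fctE !patchE; case: ifP => //.
by rewrite subr0.
Qed.

Lemma Rintegral_L2dotD f g v w : L2 f -> L2 g -> L2 v -> L2 w ->
  \int[mu]_(x in D) (f x * g x + v x * w x) = L2dot f g + L2dot v w.
Proof. by move=> *; rewrite RintegralD//; exact: integrable_L2M. Qed.

Lemma Rintegral_L2dotB f g v w : L2 f -> L2 g -> L2 v -> L2 w ->
  \int[mu]_(x in D) (f x * g x - v x * w x) = L2dot f g - L2dot v w.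
Proof. by move=> *; rewrite RintegralB//; exact: integrable_L2M. Qed.

Lemma L2dotC f g : L2dot f g = L2dot g f.
Proof. by apply: eq_Rintegral => x _; rewrite mulrC. Qed.

Lemma L2dotBl f g w : L2 f -> L2 g -> L2 w ->
  L2dot (f \- g) w = L2dot f w - L2dot g w.
Proof.
move=> lf lg lw; rewrite -RintegralB//; try exact: integrable_L2M.
by apply: eq_Rintegral => x _; rewrite mulrBl.
Qed.

Lemma L2dotBr f g w : L2 f -> L2 g -> L2 w ->
  L2dot w (f \- g) = L2dot w f - L2dot w g.
Proof. by move=> *; rewrite !(L2dotC w) L2dotBl. Qed.

Lemma L2Z a f : L2 f -> L2 (a \*o f).
Proof.
rewrite /Defs.L2 => lf.
suff -> : (a \*o f) \_ D = a *: (f \_ D) by rewrite rpredZ// lee1n.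
apply/funext => x /=; rewrite !fctE !patchE; case: ifP => //.
by rewrite scaler0.
Qed.

Lemma L2dotZl a f g : L2 f -> L2 g -> L2dot (a \*o f) g = a * L2dot f g.
Proof.
move=> lf lg; rewrite -RintegralZl//; last exact: integrable_L2M.
by apply: eq_Rintegral => x _ /=; rewrite mulrA.
Qed.

Lemma L2dot_ge0 f : 0 <= L2dot f f.
Proof. by apply: Rintegral_ge0 => x _; rewrite -expr2 sqr_ge0. Qed.

(** Cauchy-Schwarz, from the sign of the quadratic polynomial
    t |-> ||f - t g||^2. *)
Lemma L2dot_sqr_le f g : L2 f -> L2 g ->
  L2dot f g ^+ 2 <= L2dot f f * L2dot g g.
Proof.
move=> lf lg.
have quad t : 0 <= L2dot f f - 2 * t * L2dot f g + t ^+ 2 * L2dot g g.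
  have lt := L2Z t lg; have := L2dot_ge0 (f \- (t \*o g)).
  rewrite L2dotBl ?L2dotBr//; try exact: L2B.
  rewrite (L2dotC f (t \*o g)) !L2dotZl// (L2dotC g (t \*o g)) L2dotZl//.
  by rewrite (L2dotC g f); congr (_ <= _); ring.
have := L2dot_ge0 g; rewrite le_eqVlt => /predU1P[gg0|gg0].
  have [->|fg0] := eqVneq (L2dot f g) 0; first by rewrite -gg0 expr0n mulr0.
  (* with a zero leading coefficient the quadratic is affine in t *)
  have := quad ((L2dot f f + 1) / (2 * L2dot f g)); rewrite -gg0 mulr0 addr0.
  rewrite (_ : _ - _ = -1); last by field.
  by rewrite lerNr oppr0 leNgt ltr01.
have := quad (L2dot f g / L2dot g g).
rewrite (_ : _ - _ + _ = L2dot f f - L2dot f g ^+ 2 / L2dot g g).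
  by rewrite subr_ge0 ler_pdivrMr.
by field; rewrite gt_eqF.
Qed.

Lemma L2dot_null f w : L2 f -> L2 w -> L2dot w w = 0 -> L2dot w f = 0.
Proof.
move=> lf lw ww0; have := L2dot_sqr_le lw lf; rewrite ww0 mul0r => h.
by apply/eqP; rewrite -sqrf_eq0 eq_le h sqr_ge0.
Qed.

Lemma eq_L2dot_null f g : L2 f -> L2 g -> L2dot (f \- g) (f \- g) = 0 ->
  L2dot f f = L2dot g g.
Proof.
move=> lf lg fg0; have lfg := L2B lf lg.
have := L2dot_null lf lfg fg0; have := L2dot_null lg lfg fg0.
rewrite !L2dotBl// (L2dotC g f) => /eqP; rewrite subr_eq0 => /eqP <-.
by move/eqP; rewrite subr_eq0 => /eqP.
Qed.

Definition L2_cvg (f_ : (T -> R)^nat) f :=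
  L2norm (f_ n \- f) @[n --> \oo] --> 0%E.

Section convergence.
Variables (f_ : (T -> R)^nat) (f : T -> R).
Hypotheses (lf_ : forall n, L2 (f_ n)) (lf : L2 f) (cvgf : L2_cvg f_ f).

Lemma L2_cvg_sqr : L2dot (f_ n \- f) (f_ n \- f) @[n --> \oo] --> 0.
Proof.
have -> : (fun n => L2dot (f_ n \- f) (f_ n \- f)) =
    fun n => fine (L2norm (f_ n \- f)) * fine (L2norm (f_ n \- f)).
  by apply/funext => n; rewrite -expr2 sqr_L2norm//; exact: L2B.
have h : fine (L2norm (f_ n \- f)) @[n --> \oo] --> 0 by exact: fine_cvg cvgf.
by rewrite -[X in _ --> X](mulr0 0); exact: (cvgM h h).
Qed.

Lemma L2_cvg_dot g : L2 g -> L2dot (f_ n) g @[n --> \oo] --> L2dot f g.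
Proof.
move=> lg; apply/subr_cvg0.
have h : L2dot (f_ n \- f) (f_ n \- f) * L2dot g g @[n --> \oo] --> 0.
  by rewrite -[X in _ --> X](mul0r (L2dot g g)); exact: (cvgMl L2_cvg_sqr).
apply/cvgrPdist_le => e e0; have e20 : 0 < e ^+ 2 by rewrite exprn_gt0.
near=> n.
rewrite sub0r normrN -L2dotBl// -(@ler_pXn2r _ 2)// ?nnegrE ?(ltW e0)//.
rewrite real_normK ?num_real//.
apply: (le_trans (L2dot_sqr_le (L2B (lf_ n) lf) lg)).
near: n; move/cvgrPdist_le: h => /(_ _ e20); apply: filterS => n.
by rewrite sub0r normrN; apply: le_trans; rewrite ler_norm.
Unshelve. all: by end_near. Qed.

(** The parallelogram inequality
    ||f||^2 <= 2 ||f_n - f||^2 + 2 ||f_n||^2 identifies a null limit without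
    going through almost everywhere equality. *)
Lemma L2_cvg_null : L2dot (f_ n) (f_ n) @[n --> \oo] --> 0 -> L2dot f f = 0.
Proof.
move=> f_0; apply/eqP; rewrite eq_le L2dot_ge0 andbT.
have h : 2 * L2dot (f_ n \- f) (f_ n \- f) + 2 * L2dot (f_ n) (f_ n)
    @[n --> \oo] --> 0.
  rewrite -[X in _ --> X](mulr0 2) -[X in _ --> X]addr0 -{2}(mulr0 2).
  by apply: cvgD; apply: cvgMr => //; exact: L2_cvg_sqr.
rewrite -(cvg_lim _ h)//; apply: limr_ge; first by apply/cvg_ex; exists 0.
apply: nearW => n.
have := L2dot_ge0 ((f_ n \- f) \- (- 1 \*o f_ n)).
have lB := L2B (lf_ n) lf; have lZ := L2Z (- 1) (lf_ n).
rewrite (L2dotBl lB lZ (L2B lB lZ)) !L2dotBr// (L2dotC _ (_ \*o _)).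
rewrite !L2dotZl// (L2dotC _ (_ \*o _)) !L2dotZl// !L2dotBr// !L2dotBl//.
rewrite (L2dotC f); move: (L2dot f f) (L2dot (f_ n) f) => a b.
move: (L2dot (f_ n) (f_ n)) => c; lra.
Unshelve. all: by end_near. Qed.

Lemma L2_cvg_sqr_null : L2dot f f = 0 -> L2dot (f_ n) (f_ n) @[n --> \oo] --> 0.
Proof.
move=> ff0; rewrite (_ : (fun n => L2dot (f_ n) (f_ n)) =
    fun n => L2dot (f_ n \- f) (f_ n \- f)); first exact: L2_cvg_sqr.
apply/funext => n; apply: eq_L2dot_null => //; first exact: L2B.
suff -> : f_ n \- (f_ n \- f) = f by [].
by apply/funext => x /=; rewrite subKr.
Qed.

End convergence.

End L2_theory.

(** * Measurability in the plane *)

Section plane.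
Variable R : realType.
Implicit Types f F : R * R -> R.

Local Notation plane := (measurableTypeR R * measurableTypeR R)%type.

(** The Borel sets of the plane are those of the product sigma-algebra: an open
    set is the union of the countably many squares with rational centre and
    half-side that it contains. *)
Lemma open_measurable_plane (A : set (R * R)) :
  open A -> measurable (A : set plane).
Proof.
move=> oA.
pose box (q : rat * rat * rat) : set (R * R) :=
  ball (ratr q.1.1 : R) (ratr q.2) `*` ball (ratr q.1.2 : R) (ratr q.2).
pose B n := if unpickle n is Some q then
  if `[< box q `<=` A >] then box q else set0 else set0.
have -> : A = \bigcup_n B n.
  apply/seteqP; split => [[x y] Axy|z [n _]]; last first.
    by rewrite /B; case: unpickle => // q; case: asboolP => // + Bz; exact.
  have /nbhs_ballP[e /= e0 exyA] : nbhs (x, y) A by exact: open_nbhs_nbhs.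
  have e40 : 0 < e / 4 by rewrite divr_gt0.
  have close (t : R) : exists q : rat, ball t (e / 4) (ratr q).
    have : t - e / 4 < t + e / 4 by rewrite ltrBlDr -addrA ltrDl addr_gt0.
    move=> /rat_in_itvoo[q]; rewrite in_itv/= => tq; exists q.
    by rewrite /ball /= ltr_distlC.
  have [p px] := close x; have [q qy] := close y.
  (* the half-side r lies between the distance e / 4 to the rational centre
     and e / 2, so that the square contains (x, y) and stays within e of it *)
  have : e / 4 < e / 2 by lra.
  move=> /rat_in_itvoo[r]; rewrite in_itv/= => /andP[r1 r2].
  have bA : box (p, q, r) `<=` A.
    move=> [x' y'] [/= px' qy']; apply: exyA; split => /=.
    - apply: (@le_ball _ _ _ (e / 4 + ratr r)); first lra.
      exact: ball_triangle px'.
    - apply: (@le_ball _ _ _ (e / 4 + ratr r)); first lra.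
      exact: ball_triangle qy'.
  have [n qn] : exists n, unpickle n = Some (p, q, r).
    by eexists; exact: pickleK.
  exists n => //; rewrite /B qn; case: asboolP => [_|/(_ bA)//].
  by split; apply/ball_sym; apply: le_ball (ltW r1) _ _.
apply: bigcupT_measurable => n; rewrite /B; case: unpickle => // q.
case: asboolP => // _; apply: measurableX; rewrite ball_itv;
  exact: measurable_itv.
Qed.

Lemma continuous_measurable_plane f :
  continuous f -> measurable_fun setT (f : plane -> R).
Proof.
move=> /continuousP cf; apply: (measurability _ (RGenOpens.measurableE R)).
move=> _ [_ [a [b ->] <-]]; rewrite setTI; apply: open_measurable_plane.
exact/cf/interval_open.
Qed.

End plane.
(** * Integration over the rectangle *)

Section rectangle.
Variables (R : realType) (x0 y0 : R).
Hypotheses (hx0 : 0 < x0) (hy0 : 0 < y0).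
Implicit Types f F : R * R -> R.

Local Notation plane := (measurableTypeR R * measurableTypeR R)%type.
Local Notation Omega := (Omega x0 y0).

Lemma OmegaE : Omega = `]0, x0[%classic `*` `]0, y0[%classic.
Proof. by apply/seteqP; split => z /=; rewrite !in_itv. Qed.

Lemma sideE : side y0 = `[0, y0]%classic.
Proof. by apply/seteqP; split => z /=; rewrite !in_itv. Qed.

Lemma measurable_Omega : measurable (Omega : set plane).
Proof. by rewrite OmegaE; apply: measurableX; exact: measurable_itv. Qed.

Lemma measurable_side : measurable (side y0 : set (measurableTypeR R)).
Proof. by rewrite sideE; exact: measurable_itv. Qed.

Lemma leb2_Omega_lty : (leb2 R Omega < +oo)%E.
Proof.
have -> : leb2 R Omega =
      (lebesgue_measure `]0%R, x0[%classic *
       lebesgue_measure `]0%R, y0[%classic)%E.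
  by rewrite OmegaE; apply: product_measure1E; exact: measurable_itv.
by rewrite !lebesgue_measure_itv/= !lte_fin hx0 hy0 -!EFinB -EFinM ltry.
Qed.

Lemma leb1_side : leb1 R (side y0) = y0%:E.
Proof.
rewrite sideE; transitivity (lebesgue_measure `[0%R, y0]%classic) => //.
by rewrite lebesgue_measure_itv/= lte_fin hy0 sube0.
Qed.

Lemma continuous_bounded_Omega f : continuous f -> [bounded f z | z in Omega].
Proof.
move=> cf; pose K : set (R * R) := `[0, x0]%classic `*` `[0, y0]%classic.
have cK : compact K by apply: compact_setX; exact: segment_compact.
have [M [Mr MK]] := compact_bounded
  (continuous_compact (continuous_subspaceT cf) cK).
exists M; split => // N MN z /=; rewrite OmegaE => -[/= zx zy].
by apply: MK => //; exists z => //; split; exact: subset_itv_oo_cc.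
Qed.

Lemma continuous_integrable_Omega f : continuous f ->
  (leb2 R).-integrable Omega (EFin \o f).
Proof.
move=> cf; apply: measurable_bounded_integrable.
- exact: measurable_Omega.
- exact: leb2_Omega_lty.
- apply: measurable_funTS; exact: continuous_measurable_plane.
- exact: continuous_bounded_Omega.
Qed.

Lemma continuous_L2_Omega f : continuous f -> L2 (leb2 R) Omega f.
Proof.
move=> cf; apply: L2_of_sqr_integrable.
- exact: measurable_Omega.
- apply: measurable_funTS; exact: continuous_measurable_plane.
- by apply: continuous_integrable_Omega => z; apply: cvgM; exact: cf.
Qed.

Lemma continuous_integrable_side (h : R -> R) : continuous h ->
  (leb1 R).-integrable (side y0) (EFin \o h).
Proof.
rewrite sideE => ch; apply: continuous_compact_integrable.
  exact: segment_compact.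
exact: continuous_subspaceT.
Qed.

Lemma continuous_L2_side (h : R -> R) : continuous h ->
  L2 (leb1 R) (side y0) h.
Proof.
move=> ch; apply: L2_of_sqr_integrable.
- exact: measurable_side.
- apply: measurable_funTS; exact: continuous_measurable_fun.
- by apply: continuous_integrable_side => z; apply: cvgM; exact: ch.
Qed.

Lemma continuous_FTC_itvoo (F f : R -> R) (a : R) : 0 < a -> continuous f ->
  (forall x : R, is_derive x (1 : R) F (f x)) ->
  (\int[lebesgue_measure]_(x in `]0%R, a[) (f x)%:E = (F a - F 0)%:E)%E.
Proof.
move=> a0 cf dF.
have cF : continuous F.
  by move=> x; apply/differentiable_continuous/derivable1_diffP; case: (dF x).
rewrite integral_itv_obnd_cbnd; last first.
  apply: measurable_funTS; apply/measurable_EFinP.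
  exact: continuous_measurable_fun.
rewrite integral_itv_bndo_bndc; last first.
  apply: measurable_funTS; apply/measurable_EFinP.
  exact: continuous_measurable_fun.
rewrite (@continuous_FTC2 _ f F) ?EFinB//.
- exact: continuous_subspaceT.
- split.
  + by move=> x _; case: (dF x).
  + by apply: cvg_at_right_filter; exact: cF.
  + by apply: cvg_at_left_filter; exact: cF.
- by move=> x _; rewrite derive1E; case: (dF x).
Qed.

Lemma integral_side_itvoo (h : R -> R) : continuous h ->
  (\int[leb1 R]_(y in side y0) (h y)%:E =
   \int[leb1 R]_(y in `]0%R, y0[) (h y)%:E)%E.
Proof.
move=> ch; rewrite sideE [RHS]integral_itv_obnd_cbnd; last first.
  apply: measurable_funTS; apply/measurable_EFinP.
  exact: continuous_measurable_fun.
rewrite [RHS]integral_itv_bndo_bndc//.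
apply: measurable_funTS; apply/measurable_EFinP.
exact: continuous_measurable_fun.
Qed.

Lemma continuous_fix2 F (x : R) :
  continuous F -> continuous (fun y => F (x, y)).
Proof.
move=> cF y; apply: (@continuous_comp _ _ _ (fun y : R => (x, y)) F).
  by apply: (@cvg_pair _ _ _ (nbhs y) (nbhs x) (nbhs y));
    [exact: cvg_cst|exact: cvg_id].
exact: cF.
Qed.

Lemma continuous_fix1 F (y : R) :
  continuous F -> continuous (fun x => F (x, y)).
Proof.
move=> cF x; apply: (@continuous_comp _ _ _ (fun x : R => (x, y)) F).
  by apply: (@cvg_pair _ _ _ (nbhs x) (nbhs x) (nbhs y));
    [exact: cvg_id|exact: cvg_cst].
exact: cF.
Qed.

(** Fubini reduces the double integral to the fundamental theorem of calculus
    on each horizontal line. *)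
Lemma integral_Omega_dx F f : continuous F -> continuous f ->
  (forall x y : R, is_derive x (1 : R) (fun x => F (x, y)) (f (x, y))) ->
  \int[leb2 R]_(z in Omega) f z =
  \int[leb1 R]_(y in side y0) (F (x0, y) - F (0, y)).
Proof.
move=> cF cf dF.
have cd : continuous (fun y => F (x0, y) - F (0, y)).
  by move=> y; apply: continuousB; exact: continuous_fix2.
congr fine; rewrite integral_side_itvoo; last exact: cd.
rewrite integral_mkcond -integral21_prod_meas1; last first.
  apply/(integrable_mkcond _ measurable_Omega).
  exact: continuous_integrable_Omega.
rewrite [RHS]integral_mkcond; apply: eq_integral => y _.
rewrite /fubini_G [RHS]patchE; case: ifPn => [yI|yI].
  rewrite -(continuous_FTC_itvoo (F := fun x => F (x, y)) hx0
    (continuous_fix1 cf) (dF ^~ y)).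
  rewrite [RHS]integral_mkcond; apply: eq_integral => x _.
  by rewrite !patchE OmegaE in_setX/= yI andbT.
apply: integral0_eq => x _; rewrite patchE OmegaE in_setX/=.
by rewrite (negbTE yI) andbF.
Qed.

(** The vertical counterpart is only applied to functions with equal values at
    both ends of each vertical line, for which the boundary term cancels. *)
Lemma integral_Omega_dy F f : continuous F -> continuous f ->
  (forall x y : R, is_derive y (1 : R) (fun y => F (x, y)) (f (x, y))) ->
  (forall x, F (x, y0) = F (x, 0)) ->
  \int[leb2 R]_(z in Omega) f z = 0.
Proof.
move=> cF cf dF F0; rewrite /Rintegral.
rewrite integral_mkcond -integral12_prod_meas1; last first.
  apply/(integrable_mkcond _ measurable_Omega).
  exact: continuous_integrable_Omega.
rewrite integral0_eq// => x _; rewrite /fubini_F.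
have [xI|xI] := boolP (x \in (`]0, x0[%classic : set R)).
  transitivity (\int[lebesgue_measure]_(y in `]0%R, y0[) (f (x, y))%:E)%E.
    rewrite [RHS]integral_mkcond; apply: eq_integral => y _.
    by rewrite !patchE OmegaE in_setX/= xI.
  rewrite (continuous_FTC_itvoo (F := fun y => F (x, y)) hy0 _ (dF x)).
    by rewrite F0 subrr.
  exact: continuous_fix2.
apply: integral0_eq => y _; rewrite patchE OmegaE in_setX/=.
by rewrite (negbTE xI).
Qed.

End rectangle.

(** * Smooth functions, and polynomials in x *)

Section smooth.
Variable R : realType.
Implicit Types (f h phi : R * R -> R) (P : {poly R}).

(** A directional derivative along an axis is the derivative of a one-variable
    slice, which gives access to the calculus of real functions. *)
Lemma is_derive_slicex f (x y l : R) :
  is_derive (x, y) ((1, 0) : R * R) f l <->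
  is_derive x (1 : R) (fun x => f (x, y)) l.
Proof.
have E : (fun h : R => h^-1 *: ((f \o shift (x, y)) (h *: (1, 0)) - f (x, y))) =
    (fun h : R => h^-1 *: (((fun x => f (x, y)) \o shift x) (h *: (1 : R))
                           - f (x, y))).
  apply/funext => h /=; rewrite (_ : _ + (x, y) = (h *: 1 + x, y))//.
  by congr pair; rewrite /= scaler0 add0r.
split=> -[df <-]; split.
- by rewrite /derivable -E; exact: df.
- by rewrite /derive -E.
- by rewrite /derivable E; exact: df.
- by rewrite /derive E.
Qed.

Lemma is_derive_slicey f (x y l : R) :
  is_derive (x, y) ((0, 1) : R * R) f l <->
  is_derive y (1 : R) (fun y => f (x, y)) l.
Proof.
have E : (fun h : R => h^-1 *: ((f \o shift (x, y)) (h *: (0, 1)) - f (x, y))) =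
    (fun h : R => h^-1 *: (((fun y => f (x, y)) \o shift y) (h *: (1 : R))
                           - f (x, y))).
  apply/funext => h /=; rewrite (_ : _ + (x, y) = (x, h *: 1 + y))//.
  by congr pair; rewrite /= scaler0 add0r.
split=> -[df <-]; split.
- by rewrite /derivable -E; exact: df.
- by rewrite /derive -E.
- by rewrite /derivable E; exact: df.
- by rewrite /derive E.
Qed.

Lemma smooth_continuous f : smooth f -> continuous f.
Proof. by move=> /(_ 0). Qed.

Lemma smooth_continuous_dx f : smooth f -> continuous (dx f).
Proof. by move=> /(_ 1)[]. Qed.

Lemma smooth_continuous_dy f : smooth f -> continuous (dy f).
Proof. by move=> /(_ 1)[]. Qed.

Lemma smooth_is_derive_dx f x y : smooth f ->
  is_derive x (1 : R) (fun x => f (x, y)) (dx f (x, y)).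
Proof. by move=> /(_ 1)[_ df _ _ _]; exact/is_derive_slicex/derivableP. Qed.

Lemma smooth_is_derive_dy f x y : smooth f ->
  is_derive y (1 : R) (fun y => f (x, y)) (dy f (x, y)).
Proof. by move=> /(_ 1)[_ _ df _ _]; exact/is_derive_slicey/derivableP. Qed.

Lemma dxB f h : (forall z, derivable f z (1, 0)) ->
  (forall z, derivable h z (1, 0)) -> dx (f \- h) = dx f \- dx h.
Proof. by move=> df dh; apply/funext => z; rewrite /dx deriveB. Qed.

Lemma dyB f h : (forall z, derivable f z (0, 1)) ->
  (forall z, derivable h z (0, 1)) -> dy (f \- h) = dy f \- dy h.
Proof. by move=> df dh; apply/funext => z; rewrite /dy deriveB. Qed.

Lemma CkB k f h : Ck k f -> Ck k h -> Ck k (f \- h).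
Proof.
elim: k f h => [|k IH] f h /=.
  by move=> cf ch z; apply: continuousB; [exact: cf|exact: ch].
move=> [cf fx fy Cfx Cfy] [ch hx hy Chx Chy]; split.
- by move=> z; apply: continuousB; [exact: cf|exact: ch].
- by move=> z; apply: derivableB.
- by move=> z; apply: derivableB.
- by rewrite (dxB fx hx); apply: IH.
- by rewrite (dyB fy hy); apply: IH.
Qed.

Lemma smoothB f h : smooth f -> smooth h -> smooth (f \- h).
Proof. by move=> sf sh k; exact: CkB. Qed.

Definition xpoly P : R * R -> R := fun z => P.[z.1].

Lemma continuous_xpoly P : continuous (xpoly P).
Proof.
move=> z; apply: (@continuous_comp _ _ _ (@fst R R) (horner P)).
  exact: cvg_fst.
exact: continuous_horner.
Qed.

Lemma is_derive_xpoly_dx P z :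
  is_derive z ((1, 0) : R * R) (xpoly P) (xpoly P^`() z).
Proof. by case: z => x y; apply/is_derive_slicex; exact: is_derive_poly. Qed.

Lemma is_derive_xpoly_dy P z : is_derive z ((0, 1) : R * R) (xpoly P) 0.
Proof.
by case: z => x y; apply/is_derive_slicey; exact: (is_derive_cst P.[x]).
Qed.

Lemma dx_xpoly P : dx (xpoly P) = xpoly P^`().
Proof. by apply/funext => z; case: (is_derive_xpoly_dx P z). Qed.

Lemma dy_xpoly P : dy (xpoly P) = cst 0.
Proof. by apply/funext => z; case: (is_derive_xpoly_dy P z). Qed.

Lemma smooth_xpoly P : smooth (xpoly P).
Proof.
move=> k; elim: k P => [|k IH] P /=; first exact: continuous_xpoly.
split.
- exact: continuous_xpoly.
- by move=> z; case: (is_derive_xpoly_dx P z).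
- by move=> z; case: (is_derive_xpoly_dy P z).
- by rewrite dx_xpoly.
- rewrite dy_xpoly (_ : cst 0 = xpoly 0)//.
  by apply/funext => z; rewrite /xpoly horner0.
Qed.

End smooth.

(** * Green and Poincare formulas in H^1 of the rectangle *)

Section H1.
Variables (R : realType) (x0 y0 : R).
Hypotheses (hx0 : 0 < x0) (hy0 : 0 < y0).
Implicit Types (phi u v p r : R * R -> R) (t s : R -> R) (P : {poly R}).

Local Notation Omega := (Omega x0 y0).
Local Notation side := (side y0).
Local Notation L2O := (L2 (leb2 R) Omega).
Local Notation L2S := (L2 (leb1 R) side).
Local Notation dotO := (L2dot (leb2 R) Omega).
Local Notation dotS := (L2dot (leb1 R) side).
Local Notation mO := (measurable_Omega x0 y0).
Local Notation mS := (measurable_side y0).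
Local Notation H1_data := (H1_data x0 y0).

Lemma L2O_continuous phi : continuous phi -> L2O phi.
Proof. exact: continuous_L2_Omega. Qed.

Lemma L2O_smooth phi : smooth phi -> [/\ L2O phi, L2O (dx phi) & L2O (dy phi)].
Proof.
move=> sphi; split; apply: L2O_continuous.
- exact: smooth_continuous.
- exact: smooth_continuous_dx.
- exact: smooth_continuous_dy.
Qed.

Lemma L2O_xpoly P : L2O (xpoly P).
Proof. exact/L2O_continuous/continuous_xpoly. Qed.

Lemma L2S_smooth phi x : smooth phi -> L2S (fun y => phi (x, y)).
Proof.
move=> sphi; apply: continuous_L2_side.
exact/continuous_fix2/smooth_continuous.
Qed.

Lemma L2S_cst (c : R) : L2S (cst c).
Proof. by apply: continuous_L2_side => y; exact: cst_continuous. Qed.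

(** The derivative of P(x) phi(x, y) with respect to x, integrated over the
    rectangle. *)
Lemma green_smooth P phi : smooth phi ->
  dotO (dx phi) (xpoly P) + dotO phi (xpoly P^`()) =
  dotS (fun y => phi (x0, y)) (cst P.[x0])
  - dotS (fun y => phi (0, y)) (cst P.[0]).
Proof.
move=> sphi; have [lphi lphix _] := L2O_smooth sphi.
rewrite -(Rintegral_L2dotD mO)//; try exact: L2O_xpoly.
rewrite -(Rintegral_L2dotB mS); try exact: L2S_cst; try exact: L2S_smooth.
apply: (integral_Omega_dx hx0 hy0 (F := phi \* xpoly P)
  (f := dx phi \* xpoly P \+ phi \* xpoly P^`())) => [z|z|x y].
- by apply: continuousM; [exact: smooth_continuous|exact: continuous_xpoly].
- apply: continuousD; apply: continuousM; try exact: continuous_xpoly.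
    exact: smooth_continuous_dx.
  exact: smooth_continuous.
- have dphi := smooth_is_derive_dx x y sphi; have dP := is_derive_poly P x.
  apply: is_derive_eq; rewrite /xpoly /= addrC mulrC.
  by congr (_ + _); rewrite /GRing.scale/= mulrC.
Qed.

Lemma H1_data_L2 u p1 p2 t1 t2 : H1_data u p1 p2 t1 t2 ->
  [/\ L2O u, L2O p1, L2O p2, L2S t1 & L2S t2].
Proof. by move=> [[]]. Qed.

(** Both sides are continuous for the convergence that defines the traces, so
    the smooth case passes to the limit. *)
Lemma H1_green P u p1 p2 t1 t2 : H1_data u p1 p2 t1 t2 ->
  dotO p1 (xpoly P) + dotO u (xpoly P^`()) =
  dotS t2 (cst P.[x0]) - dotS t1 (cst P.[0]).
Proof.
move=> H; have [lu lp1 lp2 lt1 lt2] := H1_data_L2 H.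
case: H => _ _ _ [phi [sphi [phiu phip1 _] phit1 phit2]].
have lphi n := L2O_smooth (sphi n).
have c1 : dotO (phi n) (xpoly P^`()) @[n --> \oo] --> dotO u (xpoly P^`()).
  apply: L2_cvg_dot => //; [exact: mO| |exact: L2O_xpoly].
  by move=> n; case: (lphi n).
have c2 : dotO (dx (phi n)) (xpoly P) @[n --> \oo] --> dotO p1 (xpoly P).
  apply: (@L2_cvg_dot _ _ _ _ _ mO (fun n => dx (phi n))) => //.
    by move=> n; case: (lphi n).
  exact: L2O_xpoly.
have c3 : dotS (fun y => phi n (x0, y)) (cst P.[x0]) @[n --> \oo] -->
    dotS t2 (cst P.[x0]).
  apply: (@L2_cvg_dot _ _ _ _ _ mS (fun n y => phi n (x0, y))) => //.
    by move=> n; exact: L2S_smooth.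
  exact: L2S_cst.
have c4 : dotS (fun y => phi n (0, y)) (cst P.[0]) @[n --> \oo] -->
    dotS t1 (cst P.[0]).
  apply: (@L2_cvg_dot _ _ _ _ _ mS (fun n y => phi n (0, y))) => //.
    by move=> n; exact: L2S_smooth.
  exact: L2S_cst.
have cA := cvgD c2 c1; have cB := cvgB c3 c4.
rewrite -(cvg_lim _ (cA _))// -(cvg_lim _ (cB _))//; congr (limn _).
by apply/funext => n; exact: green_smooth.
Qed.

(** Integrating the x-derivative of (x0 - x) phi^2, whose boundary term lives
    on Gamma_1 only, expresses ||phi||^2 through the trace and through
    2 (x0 - x) phi dx phi; Young's inequality absorbs half of ||phi||^2. *)
Lemma poincare_smooth phi : smooth phi ->
  dotO phi phi <= 2 * x0 * dotS (fun y => phi (0, y)) (fun y => phi (0, y))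
                  + 4 * x0 ^+ 2 * dotO (dx phi) (dx phi).
Proof.
move=> sphi; have [lphi lphix _] := L2O_smooth sphi.
pose P : {poly R} := x0%:P - 'X.
have Px x : P.[x] = x0 - x by rewrite !hornerE.
have P'x x : P^`().[x] = -1 by rewrite derivB derivC derivX !hornerE.
have cphi := smooth_continuous sphi; have cphix := smooth_continuous_dx sphi.
pose f := xpoly P \* (phi \* dx phi \+ dx phi \* phi) \- phi \* phi.
have cf : continuous f.
  move=> z; apply: continuousB; last by apply: continuousM; exact: cphi.
  apply: continuousM; first exact: continuous_xpoly.
  by apply: continuousD; apply: continuousM; solve [exact: cphi|exact: cphix].
have If : \int[leb2 R]_(z in Omega) f z =
    - (x0 * dotS (fun y => phi (0, y)) (fun y => phi (0, y))).
  etransitivity.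
    apply: (integral_Omega_dx hx0 hy0
      (F := xpoly P \* (phi \* phi))) => [z||x y].
  - apply: continuousM; first exact: continuous_xpoly.
    by apply: continuousM; exact: cphi.
  - exact: cf.
  - have dphi := smooth_is_derive_dx x y sphi; have dP := is_derive_poly P x.
    apply: is_derive_eq; rewrite /f /xpoly /= Px P'x /GRing.scale/=; ring.
  - have l0 := L2S_smooth 0 sphi.
    rewrite -mulNr -(L2dotZl mS)//.
    apply: eq_Rintegral => y _.
    by rewrite /xpoly /= !Px subrr mul0r sub0r subr0 mulNr mulrA mulNr.
have young (x a d : R) : 0 < x -> x < x0 ->
    (x0 - x) * (a * d + d * a) - a * a <=
    2 * x0 ^+ 2 * d * d - 2^-1 * a * a.
  move=> xgt0 xlt.
  have : (x0 - x) ^+ 2 * d ^+ 2 <= x0 ^+ 2 * d ^+ 2.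
    by rewrite ler_wpM2r ?sqr_ge0// ler_pXn2r ?nnegrE//; lra.
  rewrite -subr_ge0 => dle; have : 0 <= 2^-1 * (a - 2 * (x0 - x) * d) ^+ 2.
    by rewrite mulr_ge0 ?sqr_ge0// invr_ge0.
  rewrite -subr_ge0 => sq0; rewrite -subr_ge0.
  rewrite [leRHS](_ : _ = 2^-1 * (a - 2 * (x0 - x) * d) ^+ 2 - 0 +
    2 * (x0 ^+ 2 * d ^+ 2 - (x0 - x) ^+ 2 * d ^+ 2)); last by field.
  by rewrite addr_ge0// mulr_ge0.
have fle : \int[leb2 R]_(z in Omega) f z <=
    2 * x0 ^+ 2 * dotO (dx phi) (dx phi) - 2^-1 * dotO phi phi.
  rewrite -!(L2dotZl mO)// -(Rintegral_L2dotB mO)//; try exact: L2Z.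
  apply: le_Rintegral => //.
  - exact: mO.
  - exact: (continuous_integrable_Omega hx0 hy0).
  - apply: (continuous_integrable_Omega hx0 hy0
      (f := ((cst (2 * x0 ^+ 2) \* dx phi) \* dx phi)
            \- ((cst 2^-1 \* phi) \* phi))) => z.
    by apply: continuousB; do 2 (apply: continuousM;
      last solve [exact: cphi|exact: cphix]); exact: cst_continuous.
  move=> [x y] [/= /andP[z0 zx] _]; rewrite /f /xpoly /= Px.
  exact: young.
rewrite If in fle; lra.
Qed.

(** Smooth functions approximating u have traces and x-derivatives tending to
    zero, hence tend to zero themselves by the Poincare inequality. *)
Lemma H1_null u p1 p2 t1 t2 : H1_data u p1 p2 t1 t2 ->
  dotO p1 p1 = 0 -> dotS t1 t1 = 0 -> dotO u u = 0.
Proof.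
move=> H p10 t10; have [lu lp1 lp2 lt1 lt2] := H1_data_L2 H.
case: H => _ _ _ [phi [sphi [phiu phip1 _] phit1 _]].
have lphi n := L2O_smooth (sphi n).
apply: (@L2_cvg_null _ _ _ _ _ mO phi) => //; first by move=> n; case: (lphi n).
have c1 : dotO (dx (phi n)) (dx (phi n)) @[n --> \oo] --> 0.
  apply: (@L2_cvg_sqr_null _ _ _ _ _ mO (fun n => dx (phi n)) p1) => //.
  by move=> n; case: (lphi n).
have c2 : dotS (fun y => phi n (0, y)) (fun y => phi n (0, y))
    @[n --> \oo] --> 0.
  apply: (@L2_cvg_sqr_null _ _ _ _ _ mS (fun n y => phi n (0, y)) t1) => //.
  by move=> n; exact: L2S_smooth.
have c3 : 2 * x0 * dotS (fun y => phi n (0, y)) (fun y => phi n (0, y)) +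
    4 * x0 ^+ 2 * dotO (dx (phi n)) (dx (phi n)) @[n --> \oo] -->
    2 * x0 * 0 + 4 * x0 ^+ 2 * 0.
  exact: (cvgD (cvgMl_tmp (a := 2 * x0) c2) (cvgMl_tmp (a := 4 * x0 ^+ 2) c1)).
have E : 2 * x0 * 0 + 4 * x0 ^+ 2 * 0 = 0 :> R by rewrite !mulr0 addr0.
rewrite E in c3.
have c0 : (0 : R) @[_ --> \oo] --> (0 : R) by exact: cvg_cst.
apply: squeeze_cvgr c0 c3.
by apply: nearW => n; rewrite L2dot_ge0/=; exact: poincare_smooth.
Qed.

Lemma weak_gradientB u p1 p2 v r1 r2 :
  weak_gradient Omega u p1 p2 -> weak_gradient Omega v r1 r2 ->
  weak_gradient Omega (u \- v) (p1 \- r1) (p2 \- r2).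
Proof.
move=> [lu lp1 lp2 wu] [lv lr1 lr2 wv].
split; [exact: L2B lu lv|exact: L2B lp1 lr1|exact: L2B lp2 lr2|].
move=> phi tphi; have [sphi _ _] := tphi.
have [lphi lphix lphiy] := L2O_smooth sphi.
have [ux uy] := wu phi tphi; have [vx vy] := wv phi tphi.
split.
  have := L2dotBl mO lu lv lphix; rewrite /L2dot/= => ->.
  have := L2dotBl mO lp1 lr1 lphi; rewrite /L2dot/= => ->.
  by rewrite ux vx opprB opprK addrC.
have := L2dotBl mO lu lv lphiy; rewrite /L2dot/= => ->.
have := L2dotBl mO lp2 lr2 lphi; rewrite /L2dot/= => ->.
by rewrite uy vy opprB opprK addrC.
Qed.

Lemma test_function_eq0 phi z : test_function Omega phi -> ~ Omega z ->
  phi z = 0.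
Proof.
move=> [_ _ sub] zO; apply/eqP/negPn/negP => phiz; apply/zO/sub.
exact: subset_closure.
Qed.

(** Integration by parts against a test function has no boundary terms. *)
Lemma weak_gradient_xpoly P :
  weak_gradient Omega (xpoly P) (xpoly P^`()) (cst 0).
Proof.
split; [exact: L2O_xpoly|exact: L2O_xpoly| |].
  by apply: L2O_continuous => z; exact: cst_continuous.
move=> phi tphi; have [sphi _ _] := tphi.
have [lphi lphix lphiy] := L2O_smooth sphi.
have phi0 x y : x = 0 \/ x = x0 \/ y = 0 \/ y = y0 -> phi (x, y) = 0.
  move=> xy; apply: test_function_eq0 tphi _ => -[/=] /andP[? ?] /andP[? ?].
  by move: xy => [|[|[|]]] ?; lra.
split.
  have := green_smooth P sphi.
  rewrite (L2dotC (leb2 R) _ phi) (L2dotC (leb2 R) _ (dx phi)).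
  have L0 (x c : R) : x = 0 \/ x = x0 -> dotS (fun y => phi (x, y)) (cst c) = 0.
    move=> xx; transitivity (\int[leb1 R]_(y in side) (0 : R)).
      by apply: eq_Rintegral => y _; rewrite phi0 ?mul0r//; tauto.
    by rewrite (Rintegral_cst _ mS) mul0r.
  by rewrite !L0; [rewrite subrr => /eqP; rewrite addr_eq0 => /eqP|tauto..].
rewrite [X in _ = - X](_ : _ = 0); last first.
  by rewrite /Rintegral integral0_eq// => z _ /=; rewrite mul0r.
rewrite oppr0.
apply: (integral_Omega_dy hx0 hy0 (F := xpoly P \* phi)
    (f := xpoly P \* dy phi)) => [z|z|x y|x].
- by apply: continuousM; [exact: continuous_xpoly|exact: smooth_continuous].
- by apply: continuousM; [exact: continuous_xpoly|exact: smooth_continuous_dy].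
- have dphi := smooth_is_derive_dy x y sphi.
  have dP : is_derive y (1 : R) (fun _ => P.[x]) 0 by exact: is_derive_cst.
  by apply: is_derive_eq; rewrite scaler0 addr0 /xpoly.
- by rewrite /= !phi0 ?mulr0//; tauto.
Qed.

(** A smooth function is its own approximating sequence. *)
Lemma H1_data_xpoly P :
  H1_data (xpoly P) (xpoly P^`()) (cst 0) (cst P.[0]) (cst P.[x0]).
Proof.
split; [exact: weak_gradient_xpoly|exact: L2S_cst|exact: L2S_cst|].
have norm0 d (T : measurableType d) (mu : {measure set T -> \bar R}) D
    (f_ : nat -> T -> R) :
    (forall n x, f_ n x = 0) -> L2norm mu D (f_ n) @[n --> \oo] --> 0%E.
  move=> f0; rewrite (_ : (fun n => _) = cst 0%E); first exact: cvg_cst.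
  apply/funext => n; rewrite /L2norm -[RHS](@Lnorm0 _ _ _ mu 2%:E)//.
  by apply: eq_Lnorm => x /=; rewrite patchE f0 if_same.
exists (fun=> xpoly P); split; first by move=> _; exact: smooth_xpoly.
- by split; apply: norm0 => n z /=; rewrite ?dx_xpoly ?dy_xpoly ?subrr.
- by apply: norm0 => n y /=; rewrite /xpoly/= subrr.
- by apply: norm0 => n y /=; rewrite /xpoly/= subrr.
Qed.

(** Subtracting the smooth function from every term of an approximating
    sequence leaves all the error terms unchanged. *)
Lemma H1_dataB_xpoly u p1 p2 t1 t2 P : H1_data u p1 p2 t1 t2 ->
  H1_data (u \- xpoly P) (p1 \- xpoly P^`()) (p2 \- cst 0)
          (t1 \- cst P.[0]) (t2 \- cst P.[x0]).
Proof.
move=> [wu lt1 lt2 [phi [sphi [phiu phip1 phip2] phit1 phit2]]].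
split.
- exact/weak_gradientB/weak_gradient_xpoly.
- exact: L2B lt1 (L2S_cst _).
- exact: L2B lt2 (L2S_cst _).
have BB (T : Type) (f h k : T -> R) : (f \- k) \- (h \- k) = f \- h.
  by apply/funext => z /=; rewrite opprB addrA subrK.
exists (fun n => phi n \- xpoly P); split.
- by move=> n; apply: smoothB => //; exact: smooth_xpoly.
- split.
  + by under eq_cvg do rewrite BB.
  + rewrite (_ : (fun n => _) =
        fun n => L2norm (leb2 R) Omega (dx (phi n) \- p1))//.
    apply/funext => n; have [_ dphi _ _ _] := sphi n 1%N.
    rewrite dxB ?dx_xpoly ?BB// => z; by case: (is_derive_xpoly_dx P z).
  + rewrite (_ : (fun n => _) =
        fun n => L2norm (leb2 R) Omega (dy (phi n) \- p2))//.
    apply/funext => n; have [_ _ dphi _ _] := sphi n 1%N.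
    rewrite dyB ?dy_xpoly ?BB// => z; by case: (is_derive_xpoly_dy P z).
- rewrite (_ : (fun n => _) =
      fun n => L2norm (leb1 R) side (fun y => phi n (0, y) - t1 y))//.
  apply/funext => n; congr L2norm; apply/funext => y /=.
  by rewrite /xpoly/= opprB addrA subrK.
- rewrite (_ : (fun n => _) =
      fun n => L2norm (leb1 R) side (fun y => phi n (x0, y) - t2 y))//.
  apply/funext => n; congr L2norm; apply/funext => y /=.
  by rewrite /xpoly/= opprB addrA subrK.
Qed.

End H1.

(** * Explicit states and their misfits *)

Section states.
Variables (R : realType) (x0 y0 : R).
Hypotheses (hx0 : 0 < x0) (hy0 : 0 < y0).
Implicit Types (u v p r : R * R -> R) (t s : R -> R) (P : {poly R}).

Local Notation Omega := (Omega x0 y0).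
Local Notation side := (side y0).
Local Notation L2O := (L2 (leb2 R) Omega).
Local Notation dotO := (L2dot (leb2 R) Omega).
Local Notation dotS := (L2dot (leb1 R) side).
Local Notation mO := (measurable_Omega x0 y0).
Local Notation mS := (measurable_side y0).
Local Notation H1_data := (H1_data x0 y0).

(** The solution of - u'' = g, u(0) = beta, - u'(x0) = q. *)
Definition state_poly (g q beta : R) : {poly R} :=
  beta%:P + (g * x0 - q) *: 'X - (g / 2) *: 'X^2.

Lemma state_poly_horner g q beta x :
  (state_poly g q beta).[x] = beta + (g * x0 - q) * x - g / 2 * x ^+ 2.
Proof. by rewrite !hornerE. Qed.

Lemma deriv_state_poly g q beta :
  (state_poly g q beta)^`() = (g * x0 - q)%:P - g *: 'X.
Proof.
rewrite derivB derivD derivC !derivZ derivX derivXn add0r alg_polyC.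
by rewrite -scalerMnr scalerMnl -mulr_natr divfK.
Qed.

Lemma deriv2_state_poly g q beta : (state_poly g q beta)^`()^`() = (- g)%:P.
Proof.
by rewrite deriv_state_poly derivB derivC derivZ derivX sub0r alg_polyC polyCN.
Qed.

(** Green's formula with the weight u' = g x0 - q - g x, which equals -q on
    Gamma_2 and has derivative -g.  The last term is the flux through
    Gamma_1: test functions of the Dirichlet problem annihilate it, and it is
    the quantity that the Robin condition prescribes. *)
Lemma flux_identity g q beta v r1 r2 s1 s2 : H1_data v r1 r2 s1 s2 ->
  \int[leb2 R]_(z in Omega)
    (xpoly (state_poly g q beta)^`() z * r1 z + cst 0 z * r2 z) =
  \int[leb2 R]_(z in Omega) (g * v z) - \int[leb1 R]_(y in side) (q * s2 y)
  - \int[leb1 R]_(y in side) ((g * x0 - q) * s1 y).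
Proof.
move=> H; have [lv lr1 lr2 ls1 ls2] := H1_data_L2 H.
have lP := L2O_xpoly hx0 hy0 (state_poly g q beta)^`().
have := H1_green hx0 hy0 (state_poly g q beta)^`() H.
rewrite deriv2_state_poly.
have -> : (state_poly g q beta)^`().[x0] = - q.
  by rewrite deriv_state_poly !hornerE; ring.
have -> : (state_poly g q beta)^`().[0] = g * x0 - q.
  by rewrite deriv_state_poly !hornerE; ring.
have -> : xpoly (- g)%:P = -1 \*o cst g.
  by apply/funext => z; rewrite /xpoly hornerC /= mulN1r.
have -> : cst (- q) = -1 \*o cst q :> (R -> R).
  by apply/funext => y; rewrite /= mulN1r.
rewrite (L2dotC (leb2 R) _ v) (L2dotC (leb1 R) _ s2) (L2dotC (leb1 R) _ s1)
  (L2dotC (leb2 R) _ r1).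
rewrite (L2dotZl mO)//; last first.
  by apply: L2O_continuous => // z; exact: cst_continuous.
rewrite (L2dotZl mS)//; last exact: L2S_cst.
rewrite !mulN1r => h.
have -> : \int[leb2 R]_(z in Omega)
    (xpoly (state_poly g q beta)^`() z * r1 z + cst 0 z * r2 z) =
    dotO (xpoly (state_poly g q beta)^`()) r1.
  by apply: eq_Rintegral => z _; rewrite mul0r addr0.
by move/eqP: h; rewrite subr_eq => /eqP ->; rewrite /L2dot /=; ring.
Qed.

Lemma dirichlet_solution_state_poly g q b :
  dirichlet_solution x0 y0 g q b (xpoly (state_poly g q b)).
Proof.
exists (xpoly (state_poly g q b)^`()), (cst 0), (cst (state_poly g q b).[x0]).
split.
  have := H1_data_xpoly hx0 hy0 (state_poly g q b).
  by rewrite (_ : (state_poly g q b).[0] = b)// state_poly_horner; ring.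
move=> v r1 r2 s2 H; rewrite (flux_identity _ _ _ H).
rewrite [X in _ - X](_ : _ = 0) ?subr0//.
by rewrite /Rintegral integral0_eq// => y _; rewrite mulr0.
Qed.

(** The value at x = 0 solves - du/dn = alpha (u - b), where - du/dn is the flux
    u'(0) = g x0 - q. *)
Definition robin_poly alpha g q b : {poly R} :=
  state_poly g q (b + (g * x0 - q) / alpha).

Lemma robin_identity alpha g q b v r1 r2 s1 s2 (P := robin_poly alpha g q b) :
  0 < alpha -> H1_data v r1 r2 s1 s2 ->
  \int[leb2 R]_(z in Omega) (xpoly P^`() z * r1 z + cst 0 z * r2 z)
  + alpha * \int[leb1 R]_(y in side) (cst P.[0] y * s1 y) =
  \int[leb2 R]_(z in Omega) (g * v z) - \int[leb1 R]_(y in side) (q * s2 y)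
  + alpha * \int[leb1 R]_(y in side) (b * s1 y).
Proof.
move=> alpha0 H; rewrite (flux_identity _ _ _ H).
have [_ _ _ ls1 _] := H1_data_L2 H.
have -> : \int[leb1 R]_(y in side) (cst P.[0] y * s1 y) =
    \int[leb1 R]_(y in side) (b * s1 y) +
    \int[leb1 R]_(y in side) ((g * x0 - q) * s1 y) / alpha.
  have I c : \int[leb1 R]_(y in side) (c * s1 y) =
      c * \int[leb1 R]_(y in side) (1 * s1 y).
    rewrite -(L2dotZl mS c (f := cst 1))//; last exact: L2S_cst.
    by apply: eq_Rintegral => y _ /=; rewrite mulr1.
  rewrite [LHS]I [X in _ = X + _]I [X in _ = _ + X / _]I /P state_poly_horner.
  by rewrite mulr0 expr0n/= mulr0 subr0 addr0; ring.
by field; rewrite gt_eqF.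
Qed.

Lemma robin_solution_robin_poly alpha g q b : 0 < alpha ->
  robin_solution x0 y0 alpha g q b (xpoly (robin_poly alpha g q b)).
Proof.
move=> alpha0; set P := robin_poly _ _ _ _.
exists (xpoly P^`()), (cst 0), (cst P.[0]), (cst P.[x0]); split.
  exact: H1_data_xpoly.
by move=> v r1 r2 s1 s2 H; exact: robin_identity H.
Qed.

(** The right-hand side compares two variational equations tested with the
    difference of their solutions. *)
Lemma energyB u p1 p2 t1 t2 P (r1 := p1 \- xpoly P^`()) (r2 := p2 \- cst 0) :
  H1_data u p1 p2 t1 t2 ->
  dotO r1 r1 + dotO r2 r2 =
  \int[leb2 R]_(z in Omega) (p1 z * r1 z + p2 z * r2 z) -
  \int[leb2 R]_(z in Omega) (xpoly P^`() z * r1 z + cst 0 z * r2 z).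
Proof.
move=> Hu; have [lu lp1 lp2 lt1 lt2] := H1_data_L2 Hu.
have [lw lr1 lr2 ls1 ls2] := H1_data_L2 (H1_dataB_xpoly hx0 hy0 P Hu).
have lP := L2O_xpoly hx0 hy0 P^`().
have l0 : L2O (cst 0) by apply: L2O_continuous => // z; exact: cst_continuous.
rewrite !(Rintegral_L2dotD mO)//.
rewrite {1}/r1 {2}/r2 (L2dotBl mO lp1 lP)// (L2dotBl mO lp2 l0)//; ring.
Qed.

(** The two variational equations tested with the difference w have the same
    right-hand side, so the gradient of w is null; so is its trace on
    Gamma_1, and H1_null applies. *)
Lemma dirichlet_unique g q b u : dirichlet_solution x0 y0 g q b u ->
  L2O u /\
  dotO (u \- xpoly (state_poly g q b)) (u \- xpoly (state_poly g q b)) = 0.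
Proof.
move=> [p1 [p2 [t2 [Hu Vu]]]]; set P := state_poly g q b.
have [lu _ _ _ _] := H1_data_L2 Hu; split=> //.
have := H1_dataB_xpoly hx0 hy0 P Hu.
rewrite (_ : cst b \- cst P.[0] = cst 0); last first.
  by apply/funext => y /=; rewrite /P state_poly_horner; ring.
move=> Hw; have := energyB P Hu.
have I0 : \int[leb1 R]_(y in side) ((g * x0 - q) * cst 0 y) = 0.
  by rewrite /Rintegral integral0_eq// => y _; rewrite mulr0.
rewrite (Vu _ _ _ _ Hw) (flux_identity _ _ _ Hw) I0 subr0 subrr => r0.
apply: (H1_null hx0 hy0 Hw); last first.
  by rewrite /L2dot /Rintegral integral0_eq// => y _; rewrite mulr0.
have := L2dot_ge0 (leb2 R) Omega (p1 \- xpoly P^`()).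
have := L2dot_ge0 (leb2 R) Omega (p2 \- cst 0); lra.
Qed.

(** As for the Dirichlet problem, but the energy of the difference now also
    contains alpha times its squared trace on Gamma_1; all the terms of this
    null sum are nonnegative. *)
Lemma robin_unique alpha g q b u : 0 < alpha ->
  robin_solution x0 y0 alpha g q b u -> L2O u /\
  dotO (u \- xpoly (robin_poly alpha g q b))
       (u \- xpoly (robin_poly alpha g q b)) = 0.
Proof.
move=> alpha0 [p1 [p2 [t1 [t2 [Hu Vu]]]]]; set P := robin_poly alpha g q b.
have [lu _ _ lt1 _] := H1_data_L2 Hu; split=> //.
have Hw := H1_dataB_xpoly hx0 hy0 P Hu.
have [_ _ _ ls1 _] := H1_data_L2 Hw.
have E := energyB P Hu.
have E1 := Vu _ _ _ _ _ Hw; have E2 := robin_identity g q b alpha0 Hw.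
have E3 : dotS (t1 \- cst P.[0]) (t1 \- cst P.[0]) =
    \int[leb1 R]_(y in side) (t1 y * (t1 \- cst P.[0]) y) -
    \int[leb1 R]_(y in side) (cst P.[0] y * (t1 \- cst P.[0]) y).
  by rewrite (L2dotBl mS)//; exact: L2S_cst.
have e1 := L2dot_ge0 (leb2 R) Omega (p1 \- xpoly P^`()).
have e2 := L2dot_ge0 (leb2 R) Omega (p2 \- cst 0).
have e3 := L2dot_ge0 (leb1 R) side (t1 \- cst P.[0]).
have e4 : 0 <= alpha * dotS (t1 \- cst P.[0]) (t1 \- cst P.[0]).
  by rewrite mulr_ge0// ltW.
have e5 : dotO (p1 \- xpoly P^`()) (p1 \- xpoly P^`()) +
    dotO (p2 \- cst 0) (p2 \- cst 0) +
    alpha * dotS (t1 \- cst P.[0]) (t1 \- cst P.[0]) = 0.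
  rewrite E E3 mulrBr; move: E1 E2; rewrite -/P; lra.
apply: (H1_null hx0 hy0 Hw); first lra.
have : alpha * dotS (t1 \- cst P.[0]) (t1 \- cst P.[0]) = 0 by lra.
by move=> /eqP; rewrite mulf_eq0 gt_eqF//= => /eqP.
Qed.

(** The common shape of the squared distance to zd of the Dirichlet and Robin
    states; each cost is half of it plus the penalization of the control. *)
Definition misfit (c : coeffs R) (zd g q b : R) : R :=
  x0 * y0 * (C1 c * g ^+ 2 * x0 ^+ 4 + C2 c * q ^+ 2 * x0 ^+ 2
    + C3 c * (b - zd) ^+ 2 + C4 c * g * q * x0 ^+ 3
    + C5 c * g * x0 ^+ 2 * (b - zd) + C6 c * q * x0 * (b - zd)).

Lemma integral_Omega_deriv Q :
  \int[leb2 R]_(z in Omega) xpoly Q^`() z = y0 * (Q.[x0] - Q.[0]).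
Proof.
rewrite (_ : y0 * _ = \int[leb1 R]_(y in side) (Q.[x0] - Q.[0])); last first.
  by rewrite (Rintegral_cst _ mS) leb1_side//= mulrC.
apply: (integral_Omega_dx hx0 hy0 (F := xpoly Q)) => [||x y].
- exact: continuous_xpoly.
- exact: continuous_xpoly.
- exact: is_derive_poly.
Qed.

(** With D + B x + A x^2 = u - zd, the right-hand side is y0 times the integral
    of the expanded square. *)
Lemma L2dot_state_poly zd g q beta (A := - (g / 2)) (B := g * x0 - q)
    (D := beta - zd) :
  dotO (xpoly (state_poly g q beta) \- cst zd)
       (xpoly (state_poly g q beta) \- cst zd) =
  y0 * (D ^+ 2 * x0 + B * D * x0 ^+ 2 + (B ^+ 2 + 2 * A * D) / 3 * x0 ^+ 3
        + A * B / 2 * x0 ^+ 4 + A ^+ 2 / 5 * x0 ^+ 5).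
Proof.
pose Q : {poly R} := D ^+ 2 *: 'X + (B * D) *: 'X^2
  + ((B ^+ 2 + 2 * A * D) / 3) *: 'X^3 + (A * B / 2) *: 'X^4
  + (A ^+ 2 / 5) *: 'X^5.
transitivity (y0 * (Q.[x0] - Q.[0])).
  rewrite -integral_Omega_deriv; apply: eq_Rintegral => -[x y] _.
  rewrite /xpoly /= state_poly_horner /Q !derivD !derivZ derivX !derivXn /=.
  rewrite !(hornerD, hornerZ, hornerMn, hornerXn, hornerC) /A /B /D.
  by field.
rewrite /Q !(hornerD, hornerZ, hornerXn, hornerX); ring.
Qed.

(** By Cauchy-Schwarz a null difference does not change the norm, so the choice
    of a representative of the state is immaterial. *)
Lemma sqnormH_ae zd u P : L2O u -> dotO (u \- xpoly P) (u \- xpoly P) = 0 ->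
  sqnormH x0 y0 (u \- cst zd) = dotO (xpoly P \- cst zd) (xpoly P \- cst zd).
Proof.
move=> lu uP0; have lP := L2O_xpoly hx0 hy0 P.
have lz : L2O (cst zd) by apply: L2O_continuous => // z; exact: cst_continuous.
rewrite /sqnormH (sqr_L2norm mO); last exact: L2B.
apply: (eq_L2dot_null mO); [exact: L2B|exact: L2B|].
suff -> : (u \- cst zd) \- (xpoly P \- cst zd) = u \- xpoly P by [].
by apply/funext => z /=; rewrite opprB addrA subrK.
Qed.

Lemma sqnormH_state zd g q b :
  sqnormH x0 y0 (state x0 y0 g q b \- cst zd) = misfit (C R) zd g q b.
Proof.
have := xgetPex (cst 0) (ex_intro _ _ (dirichlet_solution_state_poly g q b)).
move=> /dirichlet_unique[lu u0]; rewrite (sqnormH_ae zd lu u0) L2dot_state_poly.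
by rewrite /misfit/=; field.
Qed.

Lemma sqnormH_state_alpha alpha zd g q b : 0 < alpha ->
  sqnormH x0 y0 (state_alpha x0 y0 alpha g q b \- cst zd) =
  misfit (Calpha x0 alpha) zd g q b.
Proof.
move=> alpha0.
have := xgetPex (cst 0) (ex_intro _ _ (robin_solution_robin_poly g q b alpha0)).
move=> /(robin_unique alpha0)[lu u0].
rewrite (sqnormH_ae zd lu u0) L2dot_state_poly.
by rewrite /misfit/=; field; rewrite !gt_eqF.
Qed.

Lemma sqnormH_cst g : sqnormH x0 y0 (cst g) = x0 * y0 * g ^+ 2.
Proof.
have lg : L2O (cst g) by apply: L2O_continuous => // z; exact: cst_continuous.
rewrite /sqnormH (sqr_L2norm mO)//.
transitivity (\int[leb2 R]_(z in Omega) xpoly (g ^+ 2 *: 'X)^`() z).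
  by apply: eq_Rintegral => z _; rewrite /xpoly derivZ derivX !hornerE.
by rewrite integral_Omega_deriv !(hornerZ, hornerX); ring.
Qed.

Lemma sqnorm_side_cst q : sqnorm_side y0 (cst q) = y0 * q ^+ 2.
Proof.
rewrite /sqnorm_side (sqr_L2norm mS); last exact: L2S_cst.
transitivity (\int[leb1 R]_(y in side) (q * q)) => //.
by rewrite (Rintegral_cst _ mS) leb1_side//= mulrC.
Qed.

End states.

(** * Minimization of the quadratic costs *)

Section optimization.
Variable R : realType.

Lemma unique_minimizer_argmin (T : pointedType) (J : T -> R) a :
  unique_minimizer J a -> argmin J = a.
Proof. by move=> [Ja Ju]; exact: get_unique. Qed.

Lemma unique_minimizer_sqr (J : R -> R) (k m a : R) : 0 < k ->
  (forall x, J x = m + k * (x - a) ^+ 2) -> unique_minimizer J a /\ J a = m.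
Proof.
move=> k0 JE; have Ja : J a = m by rewrite JE subrr expr0n mulr0 addr0.
split=> //; split=> x.
  by rewrite Ja JE lerDl mulr_ge0 ?sqr_ge0// ltW.
move=> /(_ a); rewrite Ja JE gerDl pmulr_rle0// => x0.
apply/eqP; rewrite -subr_eq0 -sqrf_eq0; apply/eqP/le_anti.
by rewrite x0 sqr_ge0.
Qed.

(** The shear by t removes the cross term of a definite quadratic form in two
    variables. *)
Lemma unique_minimizer_sqr2 (J : R * R -> R) (k1 k2 m t : R) (a : R * R) :
  0 < k1 -> 0 < k2 ->
  (forall x, J x = m + (k1 * (x.1 - a.1 + t * (x.2 - a.2)) ^+ 2
                        + k2 * (x.2 - a.2) ^+ 2)) ->
  unique_minimizer J a /\ J a = m.
Proof.
move=> k10 k20 JE.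
have Ja : J a = m by rewrite JE !subrr mulr0 addr0 expr0n !mulr0 !addr0.
have ge1 x : 0 <= k1 * (x.1 - a.1 + t * (x.2 - a.2)) ^+ 2.
  by rewrite mulr_ge0 ?sqr_ge0// ltW.
have ge2 (x : R * R) : 0 <= k2 * (x.2 - a.2) ^+ 2.
  by rewrite mulr_ge0 ?sqr_ge0// ltW.
split=> //; split=> x; first by rewrite Ja JE lerDl addr_ge0.
move=> /(_ a); rewrite Ja JE gerDl => x0.
have /eqP : k2 * (x.2 - a.2) ^+ 2 = 0 by have := ge1 x; have := ge2 x; lra.
rewrite mulf_eq0 gt_eqF//= sqrf_eq0 => /eqP x2.
have /eqP : k1 * (x.1 - a.1 + t * (x.2 - a.2)) ^+ 2 = 0.
  by have := ge1 x; have := ge2 x; lra.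
rewrite mulf_eq0 gt_eqF//= sqrf_eq0 x2 mulr0 addr0 => /eqP x1.
by apply/eqP; rewrite -pair_eqE; apply/andP; split; apply/eqP/subr0_eq.
Qed.

(** What makes the misfit strictly convex in each control; the last condition
    says that the quadratic form in (g, q) has a positive determinant. *)
Definition coercive (c : coeffs R) : Prop :=
  [/\ 0 < C1 c, 0 < C2 c, 0 < C3 c & 0 < 4 * C1 c * C2 c - C4 c ^+ 2].

Variables (x0 y0 : R).
Hypotheses (hx0 : 0 < x0) (hy0 : 0 < y0).

Section quadratic_costs.
Variables (c : coeffs R) (S : R -> R -> R -> R * R -> R).
Hypothesis hc : coercive c.
Hypothesis SE : forall zd g q b,
  sqnormH x0 y0 (S g q b \- cst zd) = misfit x0 y0 c zd g q b.

Let x0n : x0 != 0. Proof. by rewrite gt_eqF. Qed.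

Lemma J1_optimum zd M1 q b : 0 < M1 ->
  unique_minimizer (J1 S x0 y0 zd M1 q b) (g_opt c x0 zd M1 q b) /\
  J1 S x0 y0 zd M1 q b (g_opt c x0 zd M1 q b) = J1_opt c x0 y0 zd M1 q b.
Proof.
move=> M0; have [c1 _ _ _] := hc.
have k0 : 0 < C1 c * x0 ^+ 4 + M1 by rewrite addr_gt0// mulr_gt0// exprn_gt0.
apply: (unique_minimizer_sqr (k := x0 * y0 / 2 * (C1 c * x0 ^+ 4 + M1))).
  by rewrite mulr_gt0// divr_gt0// mulr_gt0.
move=> g; rewrite /J1 SE sqnormH_cst// /g_opt /J1_opt /misfit.
by field; rewrite x0n/= gt_eqF.
Qed.

Lemma J2_optimum zd M2 g b : 0 < M2 ->
  unique_minimizer (J2 S x0 y0 zd M2 g b) (q_opt c x0 zd M2 g b) /\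
  J2 S x0 y0 zd M2 g b (q_opt c x0 zd M2 g b) = J2_opt c x0 y0 zd M2 g b.
Proof.
move=> M0; have [_ c2 _ _] := hc.
have k0 : 0 < C2 c * x0 ^+ 3 + M2 by rewrite addr_gt0// mulr_gt0// exprn_gt0.
apply: (unique_minimizer_sqr (k := y0 / 2 * (C2 c * x0 ^+ 3 + M2))).
  by rewrite mulr_gt0// divr_gt0.
move=> q; rewrite /J2 SE sqnorm_side_cst// /q_opt /J2_opt /misfit.
by field; rewrite x0n/= gt_eqF.
Qed.

Lemma J3_optimum zd M3 g q : 0 < M3 ->
  unique_minimizer (J3 S x0 y0 zd M3 g q) (b_opt c x0 zd M3 g q) /\
  J3 S x0 y0 zd M3 g q (b_opt c x0 zd M3 g q) = J3_opt c x0 y0 zd M3 g q.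
Proof.
move=> M0; have [_ _ c3 _] := hc.
have k0 : 0 < C3 c * x0 + M3 by rewrite addr_gt0// mulr_gt0.
apply: (unique_minimizer_sqr (k := y0 / 2 * (C3 c * x0 + M3))).
  by rewrite mulr_gt0// divr_gt0.
move=> b; rewrite /J3 SE sqnorm_side_cst// /b_opt /J3_opt /misfit.
by field; rewrite x0n/= gt_eqF.
Qed.

Lemma det_gt0 M4 M5 : 0 < M4 -> 0 < M5 ->
  0 < 4 * (C1 c + M4 / x0 ^+ 4) * (C2 c + M5 / x0 ^+ 3) - C4 c ^+ 2.
Proof.
move=> M40 M50; have [c1 c2 _ d0] := hc; apply: lt_trans d0 _.
rewrite ltrD2r -!mulrA ltr_pM2l//.
have n4 : 0 < M4 / x0 ^+ 4 by rewrite divr_gt0// exprn_gt0.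
have n5 : 0 < M5 / x0 ^+ 3 by rewrite divr_gt0// exprn_gt0.
by apply: ltr_pM => //; rewrite ?ltrDl// ltW.
Qed.

(** Gaussian elimination of g in the quadratic form; the second pivot is
    positive because the determinant is. *)
Lemma J4_optimum zd M4 M5 b : 0 < M4 -> 0 < M5 ->
  unique_minimizer (J4 S x0 y0 zd M4 M5 b) (gq_opt c x0 zd M4 M5 b) /\
  J4 S x0 y0 zd M4 M5 b (gq_opt c x0 zd M4 M5 b) = J4_opt c x0 y0 zd M4 M5 b.
Proof.
move=> M40 M50; have [c1 c2 _ _] := hc.
have d0 := det_gt0 M40 M50.
pose m1 := C1 c + M4 / x0 ^+ 4; pose m2 := C2 c + M5 / x0 ^+ 3.
have m10 : 0 < m1 by rewrite addr_gt0// divr_gt0// exprn_gt0.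
have M4E : M4 = (m1 - C1 c) * x0 ^+ 4 by rewrite /m1; field.
have M5E : M5 = (m2 - C2 c) * x0 ^+ 3 by rewrite /m2; field.
rewrite -/m1 -/m2 in d0.
apply: (unique_minimizer_sqr2 (k1 := x0 * y0 / 2 * (m1 * x0 ^+ 4))
  (k2 := x0 * y0 / 2 * x0 ^+ 2 * ((4 * m1 * m2 - C4 c ^+ 2) / (4 * m1)))
  (t := C4 c / (2 * m1 * x0))).
- by rewrite !mulr_gt0// ?invr_gt0// exprn_gt0.
- by rewrite !mulr_gt0// ?invr_gt0// ?mulr_gt0// exprn_gt0.
move=> [g q]; rewrite /J4 SE sqnormH_cst// sqnorm_side_cst// /gq_opt /J4_opt.
rewrite /Delta1 /Pi1 -/m1 -/m2 /misfit /= M4E M5E.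
by field; rewrite x0n gt_eqF//= gt_eqF//= lt_eqF// -oppr_gt0 opprB.
Qed.

End quadratic_costs.

Lemma coercive_C : coercive (C R).
Proof. by split=> /=; lra. Qed.

(** In terms of e = 1 / (alpha x0), the quantity 4 C1 C2 - C4^2 is
    1 / 240 + e / 30 + 4 e^2 / 45: the terms in e^3 and e^4 cancel. *)
Lemma coercive_Calpha alpha : 0 < alpha -> coercive (Calpha x0 alpha).
Proof.
move=> alpha0; pose e := (alpha * x0)^-1.
have e0 : 0 < e by rewrite invr_gt0 mulr_gt0.
have e20 : 0 < e ^+ 2 by rewrite exprn_gt0.
have E1 : C1 (Calpha x0 alpha) = 2 / 15 + 2 / 3 * e + e ^+ 2.
  by rewrite /= /e; field; rewrite !gt_eqF.
have E2 : C2 (Calpha x0 alpha) = 1 / 3 + e + e ^+ 2.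
  by rewrite /= /e; field; rewrite !gt_eqF.
have E4 : C4 (Calpha x0 alpha) = - (5 / 12) - 5 / 3 * e - 2 * e ^+ 2.
  by rewrite /= /e; field; rewrite !gt_eqF.
split; rewrite ?E1 ?E2 ?E4; [lra|lra|by rewrite /=|].
rewrite [ltRHS](_ : _ = 1 / 240 + e / 30 + 4 / 45 * e ^+ 2); last by field.
lra.
Qed.

End optimization.

(** * Limits at infinity with rate O(1 / a) *)

Section rates.
Variable R : realType.
Implicit Types f h : R -> R.

(** The bound alone forces the limit, so that the closure properties below only
    have to propagate bounds. *)
Lemma cvg_rateI f l (K : R) :
  (\forall a \near +oo, `|f a - l| <= K * a^-1) -> cvg_rate f l.
Proof.
move=> fl; split; last by exists K.
have K0 : K * a^-1 @[a --> +oo] --> (0 : R).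
  rewrite -[X in _ --> X](mulr0 K); apply: cvgMl_tmp.
  by apply/gtr0_cvgV0; [exact: nbhs_pinfty_gt|exact: cvg_id].
apply/cvgrPdist_le => e e0; near=> a.
rewrite distrC; apply: (@le_trans _ _ (K * a^-1)); first by near: a.
near: a; move/cvgrPdist_le: K0 => /(_ _ e0); apply: filterS => a.
by rewrite sub0r normrN; apply: le_trans; exact: ler_norm.
Unshelve. all: by end_near. Qed.

Lemma cvg_rate_cst (c : R) : cvg_rate (fun=> c) c.
Proof.
apply: (@cvg_rateI _ _ 0); near=> a.
by rewrite subrr normr0 mul0r.
Unshelve. all: by end_near. Qed.

Lemma cvg_rate_inv (c : R) : cvg_rate (fun a => c * a^-1) 0.
Proof.
apply: (@cvg_rateI _ _ `|c|); near=> a.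
rewrite subr0 normrM ler_wpM2l// ger0_norm// invr_ge0.
by near: a; exact: nbhs_pinfty_ge.
Unshelve. all: by end_near. Qed.

Lemma cvg_rate_near f h l :
  (\forall a \near +oo, f a = h a) -> cvg_rate h l -> cvg_rate f l.
Proof.
move=> fh [_ [K hl]]; apply: (@cvg_rateI _ _ K).
by apply: filterS2 fh hl => a ->.
Qed.

Lemma cvg_rateD f h l m : cvg_rate f l -> cvg_rate h m ->
  cvg_rate (fun a => f a + h a) (l + m).
Proof.
move=> [_ [K fl]] [_ [K' hm]]; apply: (@cvg_rateI _ _ (K + K')).
apply: filterS2 fl hm => a fa ha; rewrite opprD addrACA mulrDl.
by apply: le_trans (ler_normD _ _) _; exact: lerD.
Qed.

Lemma cvg_rateN f l : cvg_rate f l -> cvg_rate (fun a => - f a) (- l).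
Proof.
move=> [_ [K fl]]; apply: (@cvg_rateI _ _ K).
by apply: filterS fl => a; rewrite -opprD normrN.
Qed.

(** f h - l m = (f - l) h + l (h - m), where h is eventually bounded since it
    converges. *)
Lemma cvg_rateM f h l m : cvg_rate f l -> cvg_rate h m ->
  cvg_rate (fun a => f a * h a) (l * m).
Proof.
move=> [_ [K fl]] [cm [K' hm]].
apply: (@cvg_rateI _ _ (K * (`|m| + 1) + `|l| * K')).
have hb : \forall a \near +oo, `|h a| <= `|m| + 1.
  move/cvgrPdist_le: cm => /(_ _ ltr01); apply: filterS => a.
  rewrite distrC => ha; rewrite -lerBlDl.
  by apply: le_trans ha; exact: lerB_dist.
apply: filterS3 fl hm hb => a fa ha hba.
rewrite (_ : _ - _ = (f a - l) * h a + l * (h a - m)); last by ring.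
apply: le_trans (ler_normD _ _) _; rewrite !normrM mulrDl lerD//.
  rewrite mulrAC; apply: ler_pM => //.
by rewrite -mulrA ler_wpM2l.
Qed.

Lemma cvg_rateX f l n : cvg_rate f l -> cvg_rate (fun a => f a ^+ n) (l ^+ n).
Proof.
move=> fl; elim: n => [|n IH]; first exact: cvg_rate_cst.
rewrite exprS; under [X in cvg_rate X]eq_fun do rewrite exprS.
exact: cvg_rateM.
Qed.

(** 1 / f - 1 / l = (l - f) / (f l), where eventually |f| >= |l| / 2. *)
Lemma cvg_rateV f l :
  l != 0 -> cvg_rate f l -> cvg_rate (fun a => (f a)^-1) l^-1.
Proof.
move=> l0 [cf [K fl]]; have nl0 : 0 < `|l| by rewrite normr_gt0.
apply: (@cvg_rateI _ _ (K * (2 * `|l|^-1 ^+ 2))).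
have fb : \forall a \near +oo, `|l| / 2 <= `|f a|.
  have l20 : 0 < `|l| / 2 by rewrite divr_gt0.
  move/cvgrPdist_le: cf => /(_ _ l20); apply: filterS => a fa.
  by have := lerB_dist l (f a); lra.
apply: filterS2 fl fb => a fa fba.
have fa0 : 0 < `|f a| by apply: lt_le_trans fba; rewrite divr_gt0.
have fan : f a != 0 by rewrite -normr_gt0.
rewrite (_ : _ - _ = (l - f a) * ((f a)^-1 * l^-1)); last by field; apply/andP.
rewrite !normrM distrC !normfV [leRHS]mulrAC; apply: ler_pM => //.
rewrite expr2 mulrA ler_wpM2r ?invr_ge0//.
rewrite -[leRHS]invrK lef_pV2 ?posrE ?invr_gt0 ?mulr_gt0 ?invr_gt0//.
by rewrite invfM invrK mulrC.
Qed.

End rates.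

(** * Convergence of the optima *)

Section coefficient_rates.
Variables (R : realType) (x0 : R).
Hypothesis hx0 : 0 < x0.

Lemma cvg_rate_quadratic_inv (k0 k1 k2 : R) :
  cvg_rate (fun a => k0 + k1 * a^-1 + k2 * a^-1 ^+ 2) k0.
Proof.
have r1 := cvg_rateD (cvg_rate_cst k0) (cvg_rate_inv k1).
have r2 := cvg_rateM (cvg_rate_inv k2) (cvg_rate_inv 1).
have := cvg_rateD r1 r2; rewrite mulr0 !addr0.
by apply: cvg_rate_near; apply: nearW => a; rewrite mul1r expr2 mulrA.
Qed.

Lemma cvg_rate_coeff (p : coeffs R -> R) (k0 k1 k2 : R) :
  (forall a, 0 < a -> p (Calpha x0 a) = k0 + k1 * a^-1 + k2 * a^-1 ^+ 2) ->
  k0 = p (C R) -> cvg_rate (fun a => p (Calpha x0 a)) (p (C R)).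
Proof.
move=> pE <-; apply: (cvg_rate_near _ (cvg_rate_quadratic_inv k0 k1 k2)).
have : \forall a \near +oo, (0 : R) < a by exact: nbhs_pinfty_gt.
by apply: filterS => a; exact: pE.
Qed.

Lemma cvg_rate_C1 : cvg_rate (fun a => C1 (Calpha x0 a)) (C1 (C R)).
Proof.
apply: (@cvg_rate_coeff (@C1 R) (2 / 15) (2 / (3 * x0))
  (x0^-1 ^+ 2)) => // a a0.
by rewrite /=; field; rewrite !gt_eqF.
Qed.

Lemma cvg_rate_C2 : cvg_rate (fun a => C2 (Calpha x0 a)) (C2 (C R)).
Proof.
apply: (@cvg_rate_coeff (@C2 R) (1 / 3) x0^-1 (x0^-1 ^+ 2)) => // a a0.
by rewrite /=; field; rewrite !gt_eqF.
Qed.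

Lemma cvg_rate_C3 : cvg_rate (fun a => C3 (Calpha x0 a)) (C3 (C R)).
Proof. exact: cvg_rate_cst. Qed.

Lemma cvg_rate_C4 : cvg_rate (fun a => C4 (Calpha x0 a)) (C4 (C R)).
Proof.
apply: (@cvg_rate_coeff (@C4 R) (- (5 / 12)) (- (5 / (3 * x0)))
  (- (2 * x0^-1 ^+ 2))) => // a a0.
by rewrite /=; field; rewrite !gt_eqF.
Qed.

Lemma cvg_rate_C5 : cvg_rate (fun a => C5 (Calpha x0 a)) (C5 (C R)).
Proof.
apply: (@cvg_rate_coeff (@C5 R) (2 / 3) (2 / x0) 0) => // a a0.
by rewrite /=; field; rewrite !gt_eqF.
Qed.

Lemma cvg_rate_C6 : cvg_rate (fun a => C6 (Calpha x0 a)) (C6 (C R)).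
Proof.
apply: (@cvg_rate_coeff (@C6 R) (-1) (- (2 / x0)) 0) => // a a0.
by rewrite /=; field; rewrite !gt_eqF.
Qed.

Ltac rate := repeat first
  [ exact: cvg_rate_cst | exact: cvg_rate_C1 | exact: cvg_rate_C2
  | exact: cvg_rate_C3 | exact: cvg_rate_C4 | exact: cvg_rate_C5
  | exact: cvg_rate_C6 | apply: cvg_rateD | apply: cvg_rateN
  | apply: cvg_rateM | apply: cvg_rateX | apply: cvg_rateV ].

Variables (y0 zd g q b M1 M2 M3 M4 M5 : R).
Hypotheses (hM1 : 0 < M1) (hM2 : 0 < M2) (hM4 : 0 < M4)
  (hM5 : 0 < M5).
Let Ca := Calpha x0.

Let d1 : 0 < C1 (C R) + M1 / x0 ^+ 4.
Proof. by rewrite addr_gt0 ?divr_gt0// exprn_gt0. Qed.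
Let d2 : 0 < C2 (C R) + M2 / x0 ^+ 3.
Proof. by rewrite addr_gt0 ?divr_gt0// exprn_gt0. Qed.
Let d4 := det_gt0 hx0 (@coercive_C R) hM4 hM5.

Lemma cvg_rate_g_opt :
  cvg_rate (fun a => g_opt (Ca a) x0 zd M1 q b) (g_opt (C R) x0 zd M1 q b).
Proof.
rewrite /g_opt; rate.
by rewrite mulf_neq0// gt_eqF// mulr_gt0// exprn_gt0.
Qed.

Lemma cvg_rate_J1_opt :
  cvg_rate (fun a => J1_opt (Ca a) x0 y0 zd M1 q b)
           (J1_opt (C R) x0 y0 zd M1 q b).
Proof. rewrite /J1_opt; rate. by rewrite mulf_neq0// gt_eqF. Qed.

Lemma cvg_rate_q_opt :
  cvg_rate (fun a => q_opt (Ca a) x0 zd M2 g b) (q_opt (C R) x0 zd M2 g b).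
Proof. by rewrite /q_opt; rate; rewrite mulf_neq0// gt_eqF// mulr_gt0. Qed.

Lemma cvg_rate_J2_opt :
  cvg_rate (fun a => J2_opt (Ca a) x0 y0 zd M2 g b)
           (J2_opt (C R) x0 y0 zd M2 g b).
Proof. by rewrite /J2_opt; rate; rewrite mulf_neq0// gt_eqF. Qed.

Lemma cvg_rate_b_opt :
  cvg_rate (fun a => b_opt (Ca a) x0 zd M3 g q) (b_opt (C R) x0 zd M3 g q).
Proof. by rewrite /b_opt; rate. Qed.

Lemma cvg_rate_J3_opt :
  cvg_rate (fun a => J3_opt (Ca a) x0 y0 zd M3 g q)
           (J3_opt (C R) x0 y0 zd M3 g q).
Proof. by rewrite /J3_opt; rate. Qed.

Lemma cvg_rate_gq_opt1 :
  cvg_rate (fun a => (gq_opt (Ca a) x0 zd M4 M5 b).1)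
           (gq_opt (C R) x0 zd M4 M5 b).1.
Proof. by rewrite /gq_opt /Delta1 /=; rate; rewrite gt_eqF. Qed.

Lemma cvg_rate_gq_opt2 :
  cvg_rate (fun a => (gq_opt (Ca a) x0 zd M4 M5 b).2)
           (gq_opt (C R) x0 zd M4 M5 b).2.
Proof. by rewrite /gq_opt /Pi1 /=; rate; rewrite gt_eqF. Qed.

Lemma cvg_rate_J4_opt :
  cvg_rate (fun a => J4_opt (Ca a) x0 y0 zd M4 M5 b)
           (J4_opt (C R) x0 y0 zd M4 M5 b).
Proof.
rewrite /J4_opt; rate.
by rewrite mulf_neq0// lt_eqF// -oppr_gt0 opprB.
Qed.

End coefficient_rates.

(** * The optimal controls and their limits *)

Theorem theorem2p5 (R : realType) (x0 y0 zd M1 M2 M3 M4 M5 g q b : R)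
    (hx0 : 0 < x0) (hy0 : 0 < y0) (hM1 : 0 < M1) (hM2 : 0 < M2)
    (hM3 : 0 < M3) (hM4 : 0 < M4) (hM5 : 0 < M5) :
  let u := state x0 y0 in
  let ua := state_alpha x0 y0 in
  let Ca := Calpha x0 in
  let j1 := J1 u x0 y0 zd M1 q b in
  let j1a := fun alpha => J1 (ua alpha) x0 y0 zd M1 q b in
  let j2 := J2 u x0 y0 zd M2 g b in
  let j2a := fun alpha => J2 (ua alpha) x0 y0 zd M2 g b in
  let j3 := J3 u x0 y0 zd M3 g q in
  let j3a := fun alpha => J3 (ua alpha) x0 y0 zd M3 g q in
  let j4 := J4 u x0 y0 zd M4 M5 b in
  let j4a := fun alpha => J4 (ua alpha) x0 y0 zd M4 M5 b in
  (* i *)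
  (unique_minimizer j1 (g_opt (C R) x0 zd M1 q b) /\
   j1 (g_opt (C R) x0 zd M1 q b) = J1_opt (C R) x0 y0 zd M1 q b /\
   forall alpha, 0 < alpha ->
     unique_minimizer (j1a alpha) (g_opt (Ca alpha) x0 zd M1 q b) /\
     j1a alpha (g_opt (Ca alpha) x0 zd M1 q b)
       = J1_opt (Ca alpha) x0 y0 zd M1 q b) /\
  (* ii *)
  (unique_minimizer j2 (q_opt (C R) x0 zd M2 g b) /\
   j2 (q_opt (C R) x0 zd M2 g b) = J2_opt (C R) x0 y0 zd M2 g b /\
   forall alpha, 0 < alpha ->
     unique_minimizer (j2a alpha) (q_opt (Ca alpha) x0 zd M2 g b) /\
     j2a alpha (q_opt (Ca alpha) x0 zd M2 g b)
       = J2_opt (Ca alpha) x0 y0 zd M2 g b) /\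
  (* iii *)
  (unique_minimizer j3 (b_opt (C R) x0 zd M3 g q) /\
   j3 (b_opt (C R) x0 zd M3 g q) = J3_opt (C R) x0 y0 zd M3 g q /\
   forall alpha, 0 < alpha ->
     unique_minimizer (j3a alpha) (b_opt (Ca alpha) x0 zd M3 g q) /\
     j3a alpha (b_opt (Ca alpha) x0 zd M3 g q)
       = J3_opt (Ca alpha) x0 y0 zd M3 g q) /\
  (* iv *)
  (unique_minimizer j4 (gq_opt (C R) x0 zd M4 M5 b) /\
   j4 (gq_opt (C R) x0 zd M4 M5 b) = J4_opt (C R) x0 y0 zd M4 M5 b /\
   forall alpha, 0 < alpha ->
     unique_minimizer (j4a alpha) (gq_opt (Ca alpha) x0 zd M4 M5 b) /\
     j4a alpha (gq_opt (Ca alpha) x0 zd M4 M5 b)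
       = J4_opt (Ca alpha) x0 y0 zd M4 M5 b) /\
  (* v *)
  ([/\ cvg_rate (fun alpha => argmin (j1a alpha)) (argmin j1),
       cvg_rate (fun alpha => argmin (j2a alpha)) (argmin j2),
       cvg_rate (fun alpha => argmin (j3a alpha)) (argmin j3)
     & argmin (j4a alpha) @[alpha --> +oo] --> argmin j4 /\
       cvg_rate (fun alpha => (argmin (j4a alpha)).1) (argmin j4).1 /\
       cvg_rate (fun alpha => (argmin (j4a alpha)).2) (argmin j4).2] /\
   [/\ cvg_rate (fun alpha => j1a alpha (argmin (j1a alpha))) (j1 (argmin j1)),
       cvg_rate (fun alpha => j2a alpha (argmin (j2a alpha))) (j2 (argmin j2)),
       cvg_rate (fun alpha => j3a alpha (argmin (j3a alpha))) (j3 (argmin j3))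
     & cvg_rate (fun alpha => j4a alpha (argmin (j4a alpha)))
         (j4 (argmin j4))]).
Proof.
move=> u ua Ca j1 j1a j2 j2a j3 j3a j4 j4a.
have aC := @coercive_C R.
have aCa alpha : 0 < alpha -> coercive (Ca alpha) by exact: coercive_Calpha.
have uE zd' g' q' b' := sqnormH_state hx0 hy0 zd' g' q' b'.
have uaE alpha (a0 : 0 < alpha) zd' g' q' b' :=
  sqnormH_state_alpha hx0 hy0 zd' g' q' b' a0.
have [m1 v1] : _ /\ j1 _ = _ := J1_optimum hx0 hy0 aC uE zd q b hM1.
have [m2 v2] : _ /\ j2 _ = _ := J2_optimum hx0 hy0 aC uE zd g b hM2.
have [m3 v3] : _ /\ j3 _ = _ := J3_optimum hx0 hy0 aC uE zd g q hM3.
have [m4 v4] : _ /\ j4 _ = _ := J4_optimum hx0 hy0 aC uE zd b hM4 hM5.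
have o1 alpha (a0 : 0 < alpha) : _ /\ j1a alpha _ = _ :=
  J1_optimum hx0 hy0 (aCa alpha a0) (uaE alpha a0) zd q b hM1.
have o2 alpha (a0 : 0 < alpha) : _ /\ j2a alpha _ = _ :=
  J2_optimum hx0 hy0 (aCa alpha a0) (uaE alpha a0) zd g b hM2.
have o3 alpha (a0 : 0 < alpha) : _ /\ j3a alpha _ = _ :=
  J3_optimum hx0 hy0 (aCa alpha a0) (uaE alpha a0) zd g q hM3.
have o4 alpha (a0 : 0 < alpha) : _ /\ j4a alpha _ = _ :=
  J4_optimum hx0 hy0 (aCa alpha a0) (uaE alpha a0) zd b hM4 hM5.
have pos : \forall alpha \near +oo, (0 : R) < alpha by exact: nbhs_pinfty_gt.
do 4 (split; first by []).
have r41 : cvg_rate (fun alpha => (argmin (j4a alpha)).1) (argmin j4).1.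
  rewrite (unique_minimizer_argmin m4).
  apply: (cvg_rate_near _ (cvg_rate_gq_opt1 hx0 zd b hM4 hM5)).
  by apply: filterS pos => alpha /o4[/unique_minimizer_argmin -> _].
have r42 : cvg_rate (fun alpha => (argmin (j4a alpha)).2) (argmin j4).2.
  rewrite (unique_minimizer_argmin m4).
  apply: (cvg_rate_near _ (cvg_rate_gq_opt2 hx0 zd b hM4 hM5)).
  by apply: filterS pos => alpha /o4[/unique_minimizer_argmin -> _].
split; split.
- rewrite (unique_minimizer_argmin m1).
  apply: (cvg_rate_near _ (cvg_rate_g_opt hx0 zd q b hM1)).
  by apply: filterS pos => alpha /o1[/unique_minimizer_argmin -> _].
- rewrite (unique_minimizer_argmin m2).
  apply: (cvg_rate_near _ (cvg_rate_q_opt hx0 zd g b hM2)).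
  by apply: filterS pos => alpha /o2[/unique_minimizer_argmin -> _].
- rewrite (unique_minimizer_argmin m3).
  apply: (cvg_rate_near _ (cvg_rate_b_opt hx0 zd g q M3)).
  by apply: filterS pos => alpha /o3[/unique_minimizer_argmin -> _].
- split; last by [].
  rewrite [argmin j4]surjective_pairing.
  rewrite (_ : (fun _ => _) = fun alpha =>
    ((argmin (j4a alpha)).1, (argmin (j4a alpha)).2)); last first.
    by apply/funext => alpha; exact: surjective_pairing.
  exact: (@cvg_pair _ _ _ _ (nbhs _) (nbhs _) _ _ _ _ _ r41.1 r42.1).
- rewrite (unique_minimizer_argmin m1) v1.
  apply: (cvg_rate_near _ (cvg_rate_J1_opt hx0 y0 zd q b hM1)).
  by apply: filterS pos => alpha /o1[/unique_minimizer_argmin -> ->].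
- rewrite (unique_minimizer_argmin m2) v2.
  apply: (cvg_rate_near _ (cvg_rate_J2_opt hx0 y0 zd g b hM2)).
  by apply: filterS pos => alpha /o2[/unique_minimizer_argmin -> ->].
- rewrite (unique_minimizer_argmin m3) v3.
  apply: (cvg_rate_near _ (cvg_rate_J3_opt hx0 y0 zd g q M3)).
  by apply: filterS pos => alpha /o3[/unique_minimizer_argmin -> ->].
- rewrite (unique_minimizer_argmin m4) v4.
  apply: (cvg_rate_near _ (cvg_rate_J4_opt hx0 y0 zd b hM4 hM5)).
  by apply: filterS pos => alpha /o4[/unique_minimizer_argmin -> ->].
Qed.
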